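(* Let $G$ be a non-elementary Schottky group acting on hyperbolic space $\mathbb{H}^n$ such that $G=N\rtimes\mathbb{Z}$ for a normal subgroup $N<G$. Then $\delta_N=\delta_G$ and $N$ is of divergence type.
   Context: A Schottky group is understood in the usual sense: a finitely generated discrete group $G=\langle g_1,\dots,g_k\rangle$ of isometries of $\mathbb{H}^n$, free on $g_1,\dots,g_k$, where the generators pair $2k$ pairwise disjoint closed topological balls (with $g_i$ mapping the exterior of one ball of the $i$-th pair onto the interior of the other). $G=N\rtimes\mathbb{Z}$ means that $N$ is a normal subgroup of $G$ with $G/N\cong\mathbb{Z}$. For a Kleinian group $\Gamma$ acting on $\mathbb{H}^n$, with $d_H$ the hyperbolic distance and $0\in\mathbb{H}^n$ a base point, the Poincaré exponent is $$\delta_\Gamma=\inf\Big\{s\ge0:\ \sum_{g\in\Gamma}e^{-s\,d_H(0,g0)}<\infty\Big\}.$$ The group $\Gamma$ is of divergence type if $\sum_{g\in\Gamma}e^{-\delta_\Gamma d_H(0,g0)}=\infty$. *)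

(* Defs.v *)
From HB Require Import structures.
From mathcomp Require Import all_boot all_order all_algebra.
From mathcomp Require Import all_classical all_reals all_analysis.

Set Implicit Arguments.
Unset Strict Implicit.
Unset Printing Implicit Defensive.

Import Order.TTheory GRing.Theory Num.Theory.
Import numFieldNormedType.Exports.

Local Open Scope classical_set_scope.
Local Open Scope ring_scope.

(* The library's norm on 'rV[R]_n is the sup norm, hence this one. The topology
   of 'rV[R]_n is the same for both. *)
Definition enorm (R : realType) (n : nat) (x : 'rV[R]_n) : R :=
  Num.sqrt (\sum_i x 0 i ^+ 2).

(* Poincare ball model of H^n, its sphere at infinity, and the closed unit ball
   of R^n; as set_types they carry the topology induced by 'rV[R]_n. *)
Definition hspace (R : realType) (n : nat) := [set x : 'rV[R]_n | enorm x < 1].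
Definition hsphere (R : realType) (n : nat) := [set x : 'rV[R]_n | enorm x = 1].
Definition cball (R : realType) (n : nat) := [set x : 'rV[R]_n | enorm x <= 1].

Arguments hspace : clear implicits.
Arguments hsphere : clear implicits.
Arguments cball : clear implicits.

Definition arcosh (R : realType) (x : R) : R := ln (x + Num.sqrt (x ^+ 2 - 1)).

Definition hdist (R : realType) (n : nat) (x y : hspace R n) : R :=
  arcosh (1 + 2 * enorm (\val x - \val y) ^+ 2 /
    ((1 - enorm (\val x) ^+ 2) * (1 - enorm (\val y) ^+ 2))).

Lemma hspace0 (R : realType) (n : nat) : (0 : 'rV[R]_n) \in hspace R n.
Proof.
rewrite inE /hspace /= /enorm big1 ?sqrtr0// => i _.
by rewrite mxE expr0n.
Qed.

Definition horigin (R : realType) (n : nat) : hspace R n :=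
  exist _ 0 (hspace0 R n).

Record hisom (R : realType) (n : nat) := HIsom {
  hmap :> hspace R n -> hspace R n;
  hmap_bij : bijective hmap;
  hmap_isom : forall x y, hdist (hmap x) (hmap y) = hdist x y
}.

Section HisomGroup.
Variables (R : realType) (n : nat).
Implicit Types f g h : hisom R n.

HB.instance Definition _ := gen_eqMixin (hisom R n).
HB.instance Definition _ := gen_choiceMixin (hisom R n).

Lemma hisomP f g : hmap f = hmap g -> f = g.
Proof.
case: f g => [f bf df] [g bg dg] /= fg; subst g.
by congr HIsom; exact: Prop_irrelevance.
Qed.

Definition hisom_one : hisom R n :=
  @HIsom R n idfun (Bijective (frefl _) (frefl _)) (fun x y => erefl).

Definition hisom_mul f g : hisom R n :=
  @HIsom R n (f \o g) (bij_comp (hmap_bij f) (hmap_bij g))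
    (fun x y => etrans (hmap_isom f (g x) (g y)) (hmap_isom g x y)).

Lemma hisom_inv_subproof f :
  {g : hisom R n | cancel (hmap f) (hmap g) /\ cancel (hmap g) (hmap f)}.
Proof.
apply/cid; have [f' fK f'K] := hmap_bij f.
have f'd x y : hdist (f' x) (f' y) = hdist x y.
  by rewrite -(hmap_isom f) !f'K.
by exists (HIsom (Bijective f'K fK) f'd).
Qed.

Definition hisom_inv f : hisom R n := projT1 (hisom_inv_subproof f).

Lemma hisom_mulA : associative hisom_mul.
Proof. by move=> f g h; apply: hisomP. Qed.

Lemma hisom_mul1 : left_id hisom_one hisom_mul.
Proof. by move=> f; apply: hisomP. Qed.

Lemma hisom_1mul : right_id hisom_one hisom_mul.
Proof. by move=> f; apply: hisomP. Qed.

Lemma hisom_mulV : left_inverse hisom_one hisom_inv hisom_mul.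
Proof.
move=> f; apply: hisomP; apply/funext => x /=.
by rewrite /hisom_inv; case: hisom_inv_subproof => g [] /= + _; exact.
Qed.

Lemma hisom_mulVr : right_inverse hisom_one hisom_inv hisom_mul.
Proof.
move=> f; apply: hisomP; apply/funext => x /=.
by rewrite /hisom_inv; case: hisom_inv_subproof => g [] /= _; exact.
Qed.

(* the group law is composition *)
HB.instance Definition _ := isGroup.Build (hisom R n)
  hisom_mulA hisom_mul1 hisom_1mul hisom_mulV hisom_mulVr.

End HisomGroup.

(* The extension of an isometry to the sphere at infinity, by continuity:
   limit of g x as x tends to xi inside the ball. *)
Definition hboundary (R : realType) (n : nat) (g : hisom R n)
    (xi : hsphere R n) : 'rV[R]_n :=
  lim ((fun x : hspace R n => \val (g x)) @
    filter_from (nbhs (\val xi)) (fun U => [set x : hspace R n | U (\val x)])).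

Definition is_subgroup (gT : groupType) (G : set gT) : Prop :=
  group_closed (mem G).

(* discreteness in the isometry group with its compact-open topology *)
Definition discrete_isom (R : realType) (n : nat) (G : set (hisom R n)) : Prop :=
  \forall f \near (idfun : {compact-open, hspace R n -> hspace R n}),
    forall g, G g -> hmap g = f -> g = 1%g.

Definition kleinian (R : realType) (n : nat) (G : set (hisom R n)) : Prop :=
  is_subgroup G /\ discrete_isom G.

Definition limit_set (R : realType) (n : nat) (G : set (hisom R n)) :
    set 'rV[R]_n :=
  hsphere R n `&` closure [set \val (g (horigin R n)) | g in G].

Definition non_elementary (R : realType) (n : nat) (G : set (hisom R n)) : Prop :=
  ~ exists a b, limit_set G `<=` [set a; b].

(* A letter (i, true) stands for g_i, and (i, false) for its inverse. *)
Definition reduced_word (k : nat) (w : seq ('I_k * bool)) : bool :=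
  sorted (fun p q => q != (p.1, ~~ p.2)) w.

Definition eval_word (gT : groupType) (k : nat) (g : 'I_k -> gT)
    (w : seq ('I_k * bool)) : gT :=
  (\prod_(p <- w) (if p.2 then g p.1 else (g p.1)^-1))%g.

Definition freely_generates (gT : groupType) (k : nat) (g : 'I_k -> gT)
    (G : set gT) : Prop :=
  G = smallest (@is_subgroup gT) (range g) /\
  forall w, reduced_word w -> eval_word g w = 1%g -> w = [::].

Definition homeomorphic (X Y : topologicalType) : Prop :=
  exists f : X -> Y, exists h : Y -> X,
    [/\ continuous f, continuous h, cancel f h & cancel h f].

(* D is closed in the sphere, as it is compact. *)
Definition topological_cball (R : realType) (n : nat) (D : set (hsphere R n)) :
    Prop :=
  homeomorphic (cball R n.-1) D.

(* The balls lie in the sphere at infinity, and g_i maps the exterior of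
   D (i, false) onto the interior of D (i, true). *)
Definition pairs_balls (R : realType) (n k : nat) (g : 'I_k -> hisom R n)
    (D : 'I_k * bool -> set (hsphere R n)) : Prop :=
  [/\ forall p, topological_cball (D p),
      trivIset setT D &
      forall i, hboundary (g i) @` (~` D (i, false)) =
                [set \val x | x in (D (i, true))^°]].

Definition schottky (R : realType) (n : nat) (G : set (hisom R n)) : Prop :=
  kleinian G /\
  exists k (g : 'I_k -> hisom R n) (D : 'I_k * bool -> set (hsphere R n)),
    freely_generates g G /\ pairs_balls g D.

Definition normal_subgroup (gT : groupType) (N G : set gT) : Prop :=
  [/\ is_subgroup N, N `<=` G & forall g h, G g -> N h -> N (h ^ g)%g].

Definition left_coset (gT : groupType) (N : set gT) (g : gT) : set gT :=
  [set (g * h)%g | h in N].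

(* phi is an isomorphism from G / N, the set of left cosets, to Z. *)
Definition quotient_iso_int (gT : groupType) (G N : set gT) : Prop :=
  exists phi : set gT -> int,
    set_bij [set left_coset N g | g in G] setT phi /\
    forall g h, G g -> G h ->
      phi (left_coset N (g * h)%g) =
      phi (left_coset N g) + phi (left_coset N h).

Definition semidirect_int (gT : groupType) (G N : set gT) : Prop :=
  normal_subgroup N G /\ quotient_iso_int G N.

Definition poincare_series (R : realType) (n : nat) (G : set (hisom R n))
    (s : R) : \bar R :=
  \esum_(g in G) (expR (- s * hdist (horigin R n) (g (horigin R n))))%:E.

Definition poincare_exponent (R : realType) (n : nat) (G : set (hisom R n)) :
    \bar R :=
  ereal_inf [set s%:E | s in [set s : R | 0 <= s /\ (poincare_series G s < +oo)%E]].

(* The exponent of a Kleinian group is finite, so that fine loses nothing. *)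
Definition divergence_type (R : realType) (n : nat) (G : set (hisom R n)) : Prop :=
  poincare_series G (fine (poincare_exponent G)) = +oo%E.

(* Main.v *)
Require Import Defs.
From mathcomp Require Import all_boot all_order all_algebra.
From mathcomp Require Import all_classical all_reals all_analysis.
From mathcomp Require Import zify ring lra.

(* Write d(g) for the distance from the origin to its image under g, delta for
   the exponent of G, and w(g) = exp(- delta d(g)). Ping-pong on the sphere at
   infinity keeps the orbit points of words with different first letters apart,
   so d(uv) = d(u) + d(v) + O(1) whenever uv is reduced. Hence w is, up to
   constants, multiplicative on reduced words, and by criticality of delta the
   words of each length n >= 1 have total weight at least some c > 0.

   Let psi : G -> Z have kernel N, and suppose that w has a finite sum over N.
   Then each level set of psi has a finite sum. As |psi| grows at most linearly
   in the word length, the lower bound c forces levels j with |j| arbitrarily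
   large and weight bounded below. Cutting a word of level j at its first visit
   to j leaves a tail in N, so the words visiting j for the first time at their
   end have weight bounded below too, and by inversion so do those for -j.
   Products of the former by the latter are long, lie in finitely many levels,
   and determine their factors: their weight is bounded below however long they
   are, which contradicts the convergence. So the series of N diverges at delta,
   which gives both claims.

   All hyperbolic geometry goes through the conformal factor 1 - |x|^2: an
   isometry g preserves |x - y|^2 / ((1 - |x|^2)(1 - |y|^2)), is therefore
   Euclidean Lipschitz on the ball, and so extends to the sphere. *)

Set Implicit Arguments.
Unset Strict Implicit.
Unset Printing Implicit Defensive.

Import Order.TTheory GRing.Theory Num.Theory.
Import numFieldNormedType.Exports.

Local Open Scope classical_set_scope.
Local Open Scope ring_scope.

(** * Reduced words and finite sums *)

Section FiniteSums.
Variable R : realType.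

(** Each induction step removes [f x] from [t], and injectivity keeps the later images away from it.
    This is how words are summed through an encoding, such as a cut into two pieces. *)
Lemma ler_sum_seq_inj (T T' : eqType) (s : seq T) (t : seq T') (f : T -> T')
    (F : T -> R) (F' : T' -> R) :
  uniq s -> {in s &, injective f} ->
  (forall x, x \in s -> f x \in t /\ F x <= F' (f x)) ->
  (forall y, y \in t -> 0 <= F' y) ->
  \sum_(x <- s) F x <= \sum_(y <- t) F' y.
Proof.
elim: s t => [|x s IH] t /=.
  by move=> _ _ _ F'0; rewrite big_nil big_seq sumr_ge0.
case/andP => xs us inj sub F'0.
have [xt Fx] := sub x (mem_head _ _).
rewrite big_cons (perm_big _ (perm_to_rem xt)) /= big_cons lerD//.
apply: IH => // [y z ys zs|y ys|y /mem_rem]; last exact: F'0.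
  by apply: inj; rewrite inE ?ys ?zs orbT.
have yxs : y \in x :: s by rewrite inE ys orbT.
have [yt Fy] := sub y yxs; split => //.
have /negbTE fyx : f y != f x.
  by apply: contraNneq xs => /inj <-//; exact: mem_head.
by move: yt; rewrite (perm_mem (perm_to_rem xt)) inE fyx.
Qed.

Lemma ler_sum_seq_sub (T : eqType) (s t : seq T) (F : T -> R) :
  uniq s -> {subset s <= t} -> (forall y, y \in t -> 0 <= F y) ->
  \sum_(x <- s) F x <= \sum_(y <- t) F y.
Proof.
move=> us st F0; apply: (@ler_sum_seq_inj _ _ s t id) => // x /st.
by split.
Qed.

Definition sums_bounded (T : eqType) (P : T -> Prop) (w : T -> R) (B : R) :=
  forall t, uniq t -> (forall x, x \in t -> P x) -> \sum_(x <- t) w x <= B.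

(** If every tail carried mass above [e], successive disjoint blocks could be stacked until their
    total exceeded [B]. *)
Lemma sums_bounded_tail (T : eqType) (P : T -> Prop) (w : T -> R) (B e : R)
    (h : T -> nat) :
  sums_bounded P w B -> 0 < e ->
  exists m, sums_bounded (fun x => P x /\ (m < h x)%N) w e.
Proof.
move=> PB e0; apply: contrapT => /forallNP noT.
have step m : exists t, [/\ uniq t, forall x, x \in t -> P x,
    forall x, x \in t -> (m < h x)%N & e < \sum_(x <- t) w x].
  have /existsNP[t /not_implyP[ut /not_implyP[tP /negP]]] := noT m.
  by rewrite -ltNge => tw; exists t; split => // x /tP[].
have many K : exists t, [/\ uniq t, forall x, x \in t -> P x &
    e *+ K <= \sum_(x <- t) w x].
  elim: K => [|K [t [ut tP tw]]]; first by exists [::]; rewrite mulr0n big_nil.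
  (* Starting beyond the largest [h] used so far makes the new block disjoint from [t]. *)
  have [t' [ut' t'P t'h t'w]] := step (\max_(x <- t) h x)%N.
  exists (t ++ t'); split.
  - rewrite cat_uniq ut ut' andbT; apply/hasPn => x /t'h; apply: contraTN => xt.
    by rewrite -leqNgt; exact: leq_bigmax_seq.
  - by move=> x; rewrite mem_cat => /orP[/tP|/t'P].
  - by rewrite big_cat/= mulrSr lerD// ltW.
have [t [ut tP]] := many (Num.bound (`|B| / e)).
have := PB _ ut tP => tB /le_trans/(_ tB).
rewrite -mulr_natl leNgt => /negP; apply.
have : `|B| / e < (Num.bound (`|B| / e))%:R.
  by apply: archi_boundP; rewrite divr_ge0// ltW.
by rewrite ltr_pdivrMr//; apply: le_lt_trans; exact: ler_norm.
Qed.

End FiniteSums.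

(** * Reduced words and their values in a freely generated group *)

Section Words.
Variable k : nat.
Local Notation letter := ('I_k * bool)%type.
Implicit Types (p q l : letter) (u v w : seq letter).

Definition linv p : letter := (p.1, ~~ p.2).
Definition winv w := rev (map linv w).

Lemma linvK : involutive linv.
Proof. by case=> i b; rewrite /linv /= negbK. Qed.

Lemma linv_neq p : linv p != p.
Proof. by case: p => i []; rewrite /linv /= xpair_eqE eqxx. Qed.

Lemma winvK : involutive winv.
Proof.
move=> w; rewrite /winv map_rev revK -map_comp map_id_in// => p _.
exact: linvK.
Qed.

Lemma winv_cons p w : winv (p :: w) = rcons (winv w) (linv p).
Proof. by rewrite /winv /= rev_cons. Qed.

Lemma winv_rcons p w : winv (rcons w p) = linv p :: winv w.
Proof. by rewrite /winv map_rcons rev_rcons. Qed.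

Lemma reduced_winv w : reduced_word (winv w) = reduced_word w.
Proof.
rewrite /reduced_word rev_sorted sorted_map; apply: eq_sorted => p q /=.
by rewrite -/(linv (linv q)) linvK eq_sym.
Qed.

Lemma reduced_cat u v :
  reduced_word (u ++ v) -> reduced_word u /\ reduced_word v.
Proof. by case/cat_sorted2. Qed.

Lemma reduced_rcons_cons u l q v :
  reduced_word (rcons u l ++ q :: v) =
  [&& reduced_word (rcons u l), reduced_word (q :: v) & q != linv l].
Proof.
rewrite /reduced_word cat_rcons -[l :: _]/([:: l] ++ _) catA cats1.
rewrite sorted_cat_cons; case: u => [|p u] /=; first by rewrite andbT andbC.
by rewrite !rcons_path last_rcons -!andbA; do !bool_congr.
Qed.

Variables (gT : groupType) (g : 'I_k -> gT).

Definition eval_letter p : gT := if p.2 then g p.1 else ((g p.1)^-1)%g.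

Lemma eval_word0 : eval_word g [::] = 1%g.
Proof. by rewrite /eval_word big_nil. Qed.

Lemma eval_word_cons p w : eval_word g (p :: w) = (eval_letter p * eval_word g w)%g.
Proof. by rewrite /eval_word big_cons. Qed.

Lemma eval_word1 p : eval_word g [:: p] = eval_letter p.
Proof. by rewrite eval_word_cons eval_word0 mulg1. Qed.

Lemma eval_word_cat u v : eval_word g (u ++ v) = (eval_word g u * eval_word g v)%g.
Proof.
elim: u => [|p u IH]; first by rewrite eval_word0 mul1g.
by rewrite cat_cons !eval_word_cons IH mulgA.
Qed.

Lemma eval_letterV p : eval_letter (linv p) = ((eval_letter p)^-1)%g.
Proof. by case: p => i []; rewrite /eval_letter //= invgK. Qed.

Lemma eval_word_winv w : eval_word g (winv w) = ((eval_word g w)^-1)%g.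
Proof.
elim: w => [|p w IH]; first by rewrite eval_word0 invg1.
by rewrite winv_cons -cats1 eval_word_cat IH eval_word1 eval_letterV
  eval_word_cons invgM.
Qed.

Lemma reduced_exists w :
  exists2 v, reduced_word v & eval_word g v = eval_word g w.
Proof.
elim: w => [|p w [v rv ev]]; first by exists [::].
case: v rv ev => [|q v] rv ev.
  by exists [:: p] => //; rewrite eval_word1 eval_word_cons -ev eval_word0 mulg1.
have [qp|qp] := eqVneq q (linv p).
  exists v; first by have [] := @reduced_cat [:: q] v rv.
  by rewrite eval_word_cons -ev eval_word_cons qp eval_letterV mulgA mulgV mul1g.
exists (p :: q :: v); last by rewrite eval_word_cons ev -eval_word_cons.
by rewrite -[_ :: _]/(rcons [::] p ++ q :: v) reduced_rcons_cons rv qp.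
Qed.

Variable G : set gT.
Hypothesis fgG : freely_generates g G.

(** Equal first letters cancel. If they differ, [winv (p :: u) ++ q :: v] is reduced with value 1,
    against freeness. *)
Lemma eval_word_inj u v : reduced_word u -> reduced_word v ->
  eval_word g u = eval_word g v -> u = v.
Proof.
have [_ free] := fgG.
elim: u v => [|p u IH] [|q v]//.
- by rewrite eval_word0 => _ rv /esym/(free _ rv).
- by rewrite eval_word0 => ru _ /(free _ ru).
move=> ru rv e; have [qp|qp] := eqVneq p q.
  subst q; congr cons; apply: IH.
  - by have [] := @reduced_cat [:: p] u ru.
  - by have [] := @reduced_cat [:: p] v rv.
  - by apply: (mulgI (eval_letter p)); rewrite -!eval_word_cons.
have rw : reduced_word (winv (p :: u) ++ q :: v).
  by rewrite winv_cons reduced_rcons_cons -winv_cons reduced_winv ru rv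
    linvK eq_sym.
have := free _ rw; rewrite eval_word_cat eval_word_winv e mulVg => /(_ erefl).
by move/(congr1 size); rewrite size_cat/= addnS.
Qed.

Lemma gen_eval w : G (eval_word g w).
Proof.
have [-> _] := fgG; move=> H [HG gH]; have [H1 _] := HG.
have HM := group_closedM HG; have HV := group_closedV HG.
elim: w => [|[i b] w IH]; first by rewrite eval_word0; exact/set_mem.
rewrite eval_word_cons; apply/set_mem/HM; last exact/mem_set.
have gi : g i \in mem H by apply/mem_set/gH; exists i.
by case: b => //; exact: HV.
Qed.

Lemma gen_surj x : G x -> exists2 w, reduced_word w & eval_word g w = x.
Proof.
have [-> _] := fgG => Gx; suff [w _ <-] : [set eval_word g w | w in setT] x.
  by have [v rv <-] := reduced_exists w; exists v.
apply: (Gx [set eval_word g w | w in setT]); split.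
  split; first by apply/mem_set; exists [::] => //; rewrite eval_word0.
  move=> _ _ /set_mem[u _ <-] /set_mem[v _ <-]; apply/mem_set.
  by exists (u ++ winv v) => //; rewrite eval_word_cat eval_word_winv.
by move=> _ [i _ <-]; exists [:: (i, true)] => //; rewrite eval_word1.
Qed.

End Words.

(** * Growth of the weights of words *)

Section WordSums.
Variables (R : realType) (k : nat).
Local Notation letter := ('I_k * bool)%type.
Implicit Types (p q l : letter) (u v w : seq letter).

Definition rwords n : seq (seq letter) :=
  [seq val t | t : n.-tuple letter <- enum [pred t : n.-tuple letter | reduced_word t]].

Lemma mem_rwords n u : (u \in rwords n) = reduced_word u && (size u == n).
Proof.
apply/mapP/andP => [[t]|[ru /eqP su]].
  by rewrite mem_enum inE => rt ->; rewrite size_tuple.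
by exists (Tuple (introT eqP su)); rewrite // mem_enum.
Qed.

Lemma rwords_uniq n : uniq (rwords n).
Proof. by rewrite map_inj_uniq ?enum_uniq//; exact: val_inj. Qed.

Lemma rwords_has n : (0 < k)%N -> exists u, u \in rwords n.
Proof.
move=> k0; exists (nseq n (Ordinal k0, true)).
rewrite mem_rwords size_nseq eqxx andbT /reduced_word.
by case: n => //; elim.
Qed.

Variables (d : seq letter -> R) (C : R).
Hypothesis d0 : forall w, 0 <= d w.
Hypothesis dcat : forall u v, reduced_word (u ++ v) ->
  d u + d v <= d (u ++ v) + C.
Hypothesis C0 : 0 <= C.

Definition zsum (s : R) n := \sum_(u <- rwords n) expR (- s * d u).

Lemma zsum_ge0 s n : 0 <= zsum s n.
Proof. by apply: sumr_ge0 => u _; exact: expR_ge0. Qed.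

(** Cutting a word at position [m] is injective on words and keeps both pieces reduced; [dcat] costs
    the factor [expR (s * C)]. *)
Lemma zsumD s m n : 0 <= s ->
  zsum s (m + n) <= expR (s * C) * zsum s m * zsum s n.
Proof.
move=> s0; rewrite -mulrA /zsum big_distrlr/=.
under [X in _ * X]eq_bigr do under eq_bigr do rewrite -expRD.
rewrite -(big_allpairs_dep (h := fun x y : seq letter => (x, y))
  (F := fun z => expR (- s * d z.1 + - s * d z.2))) big_distrr/=.
apply: (@ler_sum_seq_inj _ _ _ _ _ (fun u => (take m u, drop m u))).
- exact: rwords_uniq.
- by move=> u v _ _ [e1 e2]; rewrite -(cat_take_drop m u) e1 e2 cat_take_drop.
- move=> u; rewrite mem_rwords => /andP[ru /eqP su]; split.
    have [] := @reduced_cat _ (take m u) (drop m u); first by rewrite cat_take_drop.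
    move=> rt rd; apply/allpairsP; exists (take m u, drop m u).
    split => //; rewrite mem_rwords ?rt ?rd /=; last by rewrite size_drop su addKn.
    by rewrite size_takel// su leq_addr.
  rewrite -expRD ler_expR/=.
  have := @dcat (take m u) (drop m u); rewrite cat_take_drop => /(_ ru).
  move=> /(ler_wpM2l s0); lra.
- by move=> *; rewrite mulr_ge0 ?expR_ge0.
Qed.

Lemma zsum_muln s n r j : 0 <= s ->
  zsum s (j * n + r) <= (expR (s * C) * zsum s n) ^+ j * zsum s r.
Proof.
move=> s0; elim: j => [|j IH]; first by rewrite mul0n add0n expr0 mul1r.
rewrite mulSn -addnA (le_trans (zsumD _ _ s0))// exprS -[leRHS]mulrA.
by rewrite ler_wpM2l// mulr_ge0 ?expR_ge0 ?zsum_ge0.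
Qed.

(** Write each length as [j * n + r] with [r < n]: by [zsum_muln] the sums are dominated by a
    geometric series of ratio [rho]. *)
Lemma zsum_bounded s n : 0 <= s -> (0 < n)%N -> expR (s * C) * zsum s n < 1 ->
  exists B, sums_bounded (fun u => reduced_word u) (fun u => expR (- s * d u)) B.
Proof.
move=> s0 n0; set rho := _ * _ => rho1.
have rho0 : 0 <= rho by rewrite mulr_ge0 ?expR_ge0 ?zsum_ge0.
have geo Q : \sum_(q < Q) rho ^+ q <= (1 - rho)^-1.
  rewrite -[leRHS]mul1r ler_pdivlMr ?subr_gt0// -opprB mulrN mulrC -subrX1.
  by rewrite opprB lerBlDr lerDl exprn_ge0.
exists ((1 - rho)^-1 * \sum_(r < n) zsum s r) => t ut rt.
pose Q := (\max_(x <- t) size x).+1.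
pose T := flatten [seq flatten [seq rwords (j * n + r) | r <- iota 0 n] | j <- iota 0 Q].
apply: (@le_trans _ _ (\sum_(u <- T) expR (- s * d u))).
  apply: ler_sum_seq_sub => // u ut'.
  apply/flatten_mapP; exists (size u %/ n)%N.
    rewrite mem_iota add0n ltnS (leq_trans (leq_div _ _))//.
    exact: leq_bigmax_seq.
  apply/flatten_mapP; exists (size u %% n)%N.
    by rewrite mem_iota add0n ltn_mod.
  by rewrite mem_rwords -divn_eq eqxx andbT; exact: rt.
rewrite big_flatten big_map -[iota 0 Q]/(index_iota 0 Q) big_mkord.
apply: (@le_trans _ _ (\sum_(q < Q) rho ^+ q * \sum_(r < n) zsum s r)).
  apply: ler_sum => q _; rewrite big_flatten big_map.
  rewrite -{1}[n in iota 0 n]subn0 -/(index_iota 0 n) big_mkord big_distrr/=.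
  by apply: ler_sum => r _; exact: zsum_muln.
rewrite -big_distrl/=; apply: ler_wpM2r; last exact: geo.
by apply: sumr_ge0 => r _; exact: zsum_ge0.
Qed.

Hypothesis dproper : forall T : R, exists m,
  forall u, reduced_word u -> (m < size u)%N -> T < d u.

(** With [zsum_bounded], this provides an exponent of convergence, so that the critical exponent is
    finite. *)
Lemma zsum_small : exists s n, [/\ 0 <= s, (0 < n)%N & expR (s * C) * zsum s n < 1].
Proof.
have [m dm] := dproper (C + 1).
(* Each of these [s] words has [d u > C + 1], so the product is at most [s * expR (s * C) * expR (-
   s * (C + 1)) = s * expR (- s) < 1]. *)
pose s : R := (size (rwords m.+1))%:R; exists s, m.+1; split => //.
have : expR (s * C) * zsum s m.+1 <= s * expR (- s).
  have -> : s * expR (- s) = \sum_(u <- rwords m.+1) expR (- s).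
    by rewrite big_const_seq count_predT iter_addr_0 mulr_natl.
  rewrite /zsum big_distrr/= big_seq [leRHS]big_seq; apply: ler_sum => u.
  rewrite mem_rwords => /andP[ru /eqP su]; rewrite -expRD ler_expR.
  have := dm u ru; rewrite su => /(_ (ltnSn _)) => du.
  have : 0 <= s by []. 
  nra.
move=> /le_lt_trans; apply; rewrite expRN ltr_pdivrMr ?expR_gt0// mul1r.
by apply: lt_le_trans (expR_ge1Dx _); rewrite ltrDr.
Qed.

(** There are finitely many words of length [n], so a product below 1 at [del] stays below 1 at a
    slightly smaller exponent, where [zsum_bounded] contradicts criticality. For [del = 0] the sum
    counts words, and there is at least one. *)
Lemma zsum_critical (del : R) (n : nat) : (0 < k)%N -> 0 <= del ->
  (forall s, 0 <= s -> s < del -> forall B, ~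
    sums_bounded (fun u => reduced_word u) (fun u => expR (- s * d u)) B) ->
  (0 < n)%N -> 1 <= expR (del * C) * zsum del n.
Proof.
move=> k0 del0 crit n0; rewrite leNgt; apply/negP => lt1.
have [del_gt0|] := ltP 0 del; last first.
  move=> del_le0; have del_eq0 : del = 0 by lra.
  move: lt1; rewrite del_eq0 mul0r expR0 mul1r ltNge => /negP; apply.
  have [u un] := rwords_has n k0.
  rewrite /zsum (big_rem u un)/= oppr0 mul0r expR0 lerDl.
  by apply: sumr_ge0 => ? _; exact: expR_ge0.
set rho := _ * _ in lt1.
have rho0 : 0 <= rho by rewrite mulr_ge0 ?expR_ge0 ?zsum_ge0.
pose D := \sum_(u <- rwords n) d u + 1.
have D0 : 1 <= D by rewrite lerDr sumr_ge0.
have dD u : u \in rwords n -> d u <= D.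
  move=> un; rewrite /D (big_rem u un)/= -addrA lerDl addr_ge0// sumr_ge0//.
(* Lowering the exponent by [e] multiplies the product by at most [expR (e * D)]. Since
   [e * D <= (1 - rho) / 2], this factor is at most [2 / (1 + rho)], and [2 * rho < 1 + rho]. *)
pose e := Num.min del ((1 - rho) / (2 * D)).
have e0 : 0 < e by rewrite lt_min del_gt0 divr_gt0 ?subr_gt0//; lra.
have ed : e <= del by rewrite ge_min lexx.
have eD : e * D <= (1 - rho) / 2.
  rewrite -ler_pdivlMr; last by lra.
  by rewrite /e ge_min -mulrA -invfM lexx orbT.
have sn : 0 <= del - e by rewrite subr_ge0.
have sd : del - e < del by rewrite ltrBlDr ltrDl.
suff lt1' : expR ((del - e) * C) * zsum (del - e) n < 1.
  by have [B] := zsum_bounded sn n0 lt1'; exact: crit sn sd B.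
have : expR ((del - e) * C) * zsum (del - e) n <= expR (e * D) * rho.
  rewrite /rho mulrCA ler_pM ?expR_ge0 ?zsum_ge0//.
    by rewrite ler_expR ler_wpM2r// ltW.
  rewrite /zsum big_distrr/= big_seq [leRHS]big_seq; apply: ler_sum => u un.
  rewrite -expRD ler_expR; have := ler_wpM2l (ltW e0) (dD u un); lra.
move=> /le_lt_trans; apply.
(* exp x <= 1/(1-x) *)
have x1 : expR (e * D) * (1 - e * D) <= 1.
  have := expR_ge1Dx (- (e * D)); rewrite expRN => /(ler_wpM2l (expR_ge0 (e * D))).
  by rewrite mulfV ?gt_eqF ?expR_gt0.
have x2 : 0 < expR (e * D) by exact: expR_gt0.
have : expR (e * D) * ((1 + rho) / 2) <= 1.
  by apply: le_trans x1; rewrite ler_wpM2l ?(ltW x2)//; lra.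
by move=> h; apply: lt_le_trans h; rewrite ltr_pM2l//; lra.
Qed.

End WordSums.

(** * Recurrence of the level process *)

Lemma ler_sum_fibers (R : realType) (T : eqType) (J : eqType) (t : seq T) (lv : seq J)
    (f : T -> J) (w : T -> R) : (forall x, 0 <= w x) ->
  (forall x, x \in t -> f x \in lv) ->
  \sum_(x <- t) w x <= \sum_(j <- lv) \sum_(x <- t | f x == j) w x.
Proof.
move=> w0 tlv; rewrite (exchange_big_dep xpredT)//= big_seq [leRHS]big_seq.
apply: ler_sum => x xt; rewrite (big_rem _ (tlv x xt))/= eqxx lerDl.
exact: sumr_ge0.
Qed.

Section Recurrence.
Variables (R : realType) (k : nat) (gT : groupType) (g : 'I_k -> gT) (G : set gT).
Variables (dd : gT -> R) (C : R) (psi : gT -> int) (del c B : R).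
Local Notation letter := ('I_k * bool)%type.
Local Notation ev := (eval_word g).
Implicit Types (p q l : letter) (u v a b : seq letter) (t : seq (seq letter)) (j : int).

Hypothesis fgG : freely_generates g G.
Hypothesis C0 : 0 <= C.
Hypothesis ddV : forall x, dd (x^-1)%g = dd x.
Hypothesis ddM : forall x y, dd (x * y)%g <= dd x + dd y + C.
Hypothesis ddred : forall u v, reduced_word (u ++ v) ->
  dd (ev u) + dd (ev v) <= dd (ev (u ++ v)) + C.
Hypothesis psiM : forall x y, G x -> G y -> psi (x * y)%g = psi x + psi y.
Hypothesis psi_surj : forall j, exists2 x, G x & psi x = j.
Hypothesis k1 : (1 < k)%N.
Hypothesis del0 : 0 <= del.
Hypothesis c0 : 0 < c.
Hypothesis zsum_low : forall n, (0 < n)%N -> c <= zsum (fun u => dd (ev u)) del n.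
Hypothesis kernel_bounded : sums_bounded (fun x => G x /\ psi x = 0)
  (fun x => expR (- del * dd x)) B.

Let w u := expR (- del * dd (ev u)).
Let pw u := psi (ev u).
Let E := expR (del * C).

Let w_gt0 u : 0 < w u. Proof. exact: expR_gt0. Qed.
Let w_ge0 u : 0 <= w u. Proof. exact: expR_ge0. Qed.
Let E_gt0 : 0 < E. Proof. exact: expR_gt0. Qed.

Let GM x y : G x -> G y -> G (x * y)%g.
Proof.
move=> /(gen_surj fgG)[u _ <-] /(gen_surj fgG)[v _ <-].
by rewrite -eval_word_cat; exact: gen_eval.
Qed.

Let psi1 : psi 1%g = 0.
Proof.
have G1 : G 1%g by rewrite -(eval_word0 g); exact: gen_eval.
by have := psiM G1 G1; rewrite mulg1; lia.
Qed.

Let pw_cat u v : pw (u ++ v) = pw u + pw v.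
Proof. by rewrite /pw eval_word_cat psiM//; exact: gen_eval. Qed.

Let pw0 : pw [::] = 0. Proof. by rewrite /pw eval_word0. Qed.

Let pw_winv u : pw (winv u) = - pw u.
Proof.
have := psiM (gen_eval fgG u) (gen_eval fgG (winv u)).
by rewrite eval_word_winv mulgV psi1 -eval_word_winv /pw; lia.
Qed.

Let w_winv u : w (winv u) = w u.
Proof. by rewrite /w eval_word_winv ddV. Qed.

Let w_cat_ge u v : w u * w v <= E * w (u ++ v).
Proof.
rewrite -!expRD ler_expR eval_word_cat.
have := ler_wpM2l del0 (ddM (ev u) (ev v)); lra.
Qed.

Let w_cat_le u v : reduced_word (u ++ v) -> w (u ++ v) <= E * (w u * w v).
Proof.
move=> r; rewrite -!expRD ler_expR.
have := ler_wpM2l del0 (ddred r); lra.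
Qed.

(** Right translation by a fixed [h] of level [- j] sends this level into the kernel, at the cost of
    a constant factor. *)
Let level j :
  exists Bj, sums_bounded (fun u => reduced_word u /\ pw u = j) w Bj.
Proof.
have [h Gh psih] := psi_surj (- j).
exists (expR (del * (dd h + C)) * B) => t ut tP.
apply: (@le_trans _ _ (expR (del * (dd h + C)) *
    \sum_(x <- [seq (ev u * h)%g | u <- t]) expR (- del * dd x))).
  rewrite big_map big_distrr/=; apply: ler_sum => u _.
  rewrite -expRD ler_expR.
  have := ler_wpM2l del0 (ddM (ev u) h); lra.
rewrite ler_wpM2l ?expR_ge0//; apply: kernel_bounded.
  rewrite map_inj_in_uniq// => u v /tP[ru _] /tP[rv _] /mulIg.
  exact: (eval_word_inj fgG).
move=> _ /mapP[u /tP[ru uj] ->]; split; first by apply: GM => //; exact: gen_eval.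
by rewrite psiM//; [rewrite psih -/(pw u) uj addrN | exact: gen_eval].
Qed.

Let levels (lv : seq int) :
  exists Bl, sums_bounded (fun u => reduced_word u /\ pw u \in lv) w Bl.
Proof.
have [Bf BfP] := choice level.
exists (\sum_(j <- lv) Bf j) => t ut tP.
apply: le_trans (ler_sum_fibers w_ge0 (fun x xt => (tP x xt).2)) _.
apply: ler_sum => j _; rewrite -big_filter; apply: BfP.
  exact: filter_uniq.
by move=> u; rewrite mem_filter => /andP[/eqP ? /tP[]].
Qed.

Let pw_lin : exists2 M, (0 < M)%N & forall u, (`|pw u| <= M * size u)%N.
Proof.
exists (\sum_(p : letter) `|pw [:: p]|).+1%N => // u.
elim: u => [|p u IH]; first by rewrite pw0.
rewrite -cat1s pw_cat size_cat/= mulnDr muln1.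
have : (`|pw [:: p]| <= \sum_(p : letter) `|pw [:: p]|)%N.
  by rewrite (bigD1 p)//= leq_addr.
move: IH; set S := (\sum_(p : letter) _)%N; move: (S.+1 * size u)%N => n.
by move: (pw _) (pw u) => x y; lia.
Qed.

Let words_mass L : exists t, [/\ uniq t,
  forall u, u \in t -> reduced_word u /\ (size u <= L)%N &
  c *+ L <= \sum_(u <- t) w u].
Proof.
elim: L => [|L [t [ut tP tw]]]; first by exists [::]; rewrite big_nil mulr0n.
exists (t ++ rwords k L.+1); split.
- rewrite cat_uniq ut rwords_uniq andbT; apply/hasPn => u.
  rewrite mem_rwords => /andP[_ /eqP su]; apply/negP => /tP[_].
  by rewrite su ltnn.
- move=> u; rewrite mem_cat mem_rwords => /orP[/tP[ru su]|/andP[ru /eqP ->]]//.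
  by split=> //; exact: leqW.
- by rewrite big_cat/= mulrSr lerD//; exact: zsum_low.
Qed.

(** Words of length at most [L] weigh at least [c * L] and meet only levels of size at most [M * L].
    Levels up to [J0] weigh at most [B0]; if all others weighed less than [c1], the total would be
    at most [B0 + c * L / 2 + 2 * c1], which is too small for large [L]. *)
Let large_level : exists2 c1, 0 < c1 & forall J0 : nat, exists j t,
  [/\ (J0 < `|j|)%N, uniq t, forall u, u \in t -> reduced_word u /\ pw u = j &
   c1 <= \sum_(u <- t) w u].
Proof.
have [M M0 pwM] := pw_lin.
pose c1 := c / (4 * M%:R).
have M0' : 0 < M%:R :> R by rewrite ltr0n.
exists c1 => [|J0]; first by rewrite divr_gt0// mulr_gt0.
apply: contrapT => /forallNP nolevel.
(* This list contains 0 twice, hence its length [2 * n.+1] in the count below. *)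
pose ints n := [seq Posz m | m <- iota 0 n.+1] ++ [seq - Posz m | m <- iota 0 n.+1].
have mem_ints n j : (`|j| <= n)%N -> j \in ints n.
  move=> jn; rewrite mem_cat; case: (leP 0 j) => j0; apply/orP; [left|right];
  by apply/mapP; exists `|j|%N; rewrite ?mem_iota//; lia.
have [B0 B0P] := levels (ints J0).
pose L := (Num.bound (2 * `|B0 + 2 * c1| / c)).+1.
have [t [ut tP tw]] := words_mass L.
pose t1 := [seq u <- t | (`|pw u| <= J0)%N].
pose t2 := [seq u <- t | ~~ (`|pw u| <= J0)%N].
have tE : \sum_(u <- t) w u = \sum_(u <- t1) w u + \sum_(u <- t2) w u.
  by rewrite (bigID (fun u => (`|pw u| <= J0)%N))/= !big_filter.
have t1B : \sum_(u <- t1) w u <= B0.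
  apply: B0P; first exact: filter_uniq.
  by move=> u; rewrite mem_filter => /andP[/mem_ints ? /tP[]].
have t2B : \sum_(u <- t2) w u <= c1 * (2 * (M * L).+1)%:R.
  have -> : c1 * (2 * (M * L).+1)%:R = \sum_(j <- ints (M * L)%N) c1.
    rewrite big_const_seq count_predT iter_addr_0 size_cat !size_map size_iota.
    by rewrite addnn -mul2n mulr_natr.
  have t2i u : u \in t2 -> pw u \in ints (M * L)%N.
    rewrite mem_filter => /andP[_ /tP[_ su]]; apply/mem_ints.
    by rewrite (leq_trans (pwM u))// leq_mul2l su orbT.
  apply: le_trans (ler_sum_fibers w_ge0 t2i) _.
  apply: ler_sum => j _; have [jJ|jJ] := leqP `|j| J0.
    rewrite big_seq_cond big1 ?divr_ge0 ?mulr_ge0 ?ltW// => u.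
    by rewrite mem_filter => /andP[/andP[+ _] /eqP uj]; rewrite uj jJ.
  rewrite leNgt; apply/negP => /ltW lt; apply: (nolevel j).
  exists [seq u <- t2 | pw u == j]; split; rewrite ?big_filter//.
    by rewrite !filter_uniq.
  by move=> u; rewrite !mem_filter => /and3P[/eqP ? _ /tP[]].
have c1M : c1 * (2 * (M * L).+1)%:R = c * L%:R / 2 + 2 * c1.
  rewrite /c1 natrM -[(M * L).+1]addn1 natrD natrM; field; exact: lt0r_neq0.
have : c * L%:R <= (B0 + 2 * c1) + c * L%:R / 2.
  by move: tw; rewrite -mulr_natr tE; lra.
have : 2 * `|B0 + 2 * c1| / c < L%:R.
  apply: (@lt_trans _ _ (Num.bound (2 * `|B0 + 2 * c1| / c))%:R).
    by apply: archi_boundP; rewrite divr_ge0 ?mulr_ge0// ltW.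
  by rewrite ltr_nat.
rewrite ltr_pdivrMr//; have := ler_norm (B0 + 2 * c1); nra.
Qed.

Definition first_hit j a := pw a = j /\ forall i, (i < size a)%N -> pw (take i a) <> j.

(** If the lengths differed, the shorter prefix would be a proper prefix of the longer one and would
    already have reached [j]. *)
Let first_hit_inj j a a' x x' : first_hit j a -> first_hit j a' ->
  a ++ x = a' ++ x' -> a = a' /\ x = x'.
Proof.
move=> [pa ha] [pa' ha'] e.
have sz : size a = size a'.
  apply/eqP; rewrite eqn_leq; apply/andP; split; rewrite leqNgt; apply/negP => lt.
    apply: (ha _ lt); rewrite -pa' -(@takel_cat _ _ _ x) 1?ltnW//.
    by rewrite e take_size_cat.
  apply: (ha' _ lt); rewrite -pa -(@takel_cat _ _ _ x') 1?ltnW//.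
  by rewrite -e take_size_cat.
by move/eqP: e; rewrite eqseq_cat// => /andP[/eqP -> /eqP ->].
Qed.

(** Cut each word of [t] at its first visit to [j]. The tails have level 0, so they weigh at most
    [B0], and the weight of [t] is at most [E * B0] times that of the prefixes. *)
Let first_hit_mass j t c1 B0 : 0 < B0 ->
  sums_bounded (fun u => reduced_word u /\ pw u = 0) w B0 ->
  uniq t -> (forall u, u \in t -> reduced_word u /\ pw u = j) ->
  c1 <= \sum_(u <- t) w u ->
  exists A, [/\ uniq A, forall a, a \in A -> reduced_word a /\ first_hit j a &
    c1 / (E * B0) <= \sum_(a <- A) w a].
Proof.
move=> B0_gt0 B0P ut tP tw.
pose hit u i := pw (take i u) == j.
(* The search succeeds because the whole word, at position [size u], has level [j]. *)
pose i u := find (hit u) (iota 0 (size u).+1).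
have hasi u : u \in t -> has (hit u) (iota 0 (size u).+1).
  move=> /tP[_ uj]; apply/hasP; exists (size u).
    by rewrite mem_iota add0n ltnS leqnn.
  by rewrite /hit take_size uj.
have il u : u \in t -> (i u <= size u)%N.
  by move=> ut'; have := hasi u ut'; rewrite has_find size_iota ltnS.
have pi u : u \in t -> pw (take (i u) u) = j.
  move=> ut'; have := nth_find 0%N (hasi u ut'); rewrite nth_iota ?add0n//.
    by move/eqP.
  by rewrite ltnS il.
have fi u n : u \in t -> (n < i u)%N -> pw (take n u) <> j.
  move=> ut' ni; have := before_find 0%N ni; rewrite nth_iota ?add0n => [/eqP//|].
  by rewrite (leq_trans ni)// leqW// il.
pose A := undup [seq take (i u) u | u <- t].
pose D := undup [seq drop (i u) u | u <- t].
exists A; split; first exact: undup_uniq.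
  move=> a; rewrite mem_undup => /mapP[u ut' ->].
  have [ru _] := tP u ut'; split.
    by apply: (@reduced_cat _ _ (drop (i u) u) _).1; rewrite cat_take_drop.
  split; first exact: pi.
  move=> n; rewrite size_takel ?il// => ni; rewrite take_takel ?(ltnW ni)//.
  exact: fi.
have DB : \sum_(b <- D) w b <= B0.
  apply: B0P; first exact: undup_uniq.
  move=> b; rewrite mem_undup => /mapP[u ut' ->].
  have [ru uj] := tP u ut'; split.
    by apply: (@reduced_cat _ (take (i u) u) _ _).2; rewrite cat_take_drop.
  have := pw_cat (take (i u) u) (drop (i u) u).
  by rewrite cat_take_drop pi// uj -{1}[j]addr0 => /addrI.
rewrite ler_pdivrMr ?mulr_gt0//; apply: le_trans tw _.
apply: (@le_trans _ _ (E * ((\sum_(a <- A) w a) * (\sum_(b <- D) w b)))); last first.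
  rewrite mulrCA; apply: ler_wpM2l; first exact: sumr_ge0.
  by apply: ler_wpM2l => //; exact: ltW.
rewrite big_distrlr/= -(big_allpairs_dep (h := fun x y : seq letter => (x, y))
  (F := fun z => w z.1 * w z.2)) big_distrr/=.
apply: (@ler_sum_seq_inj _ _ _ _ _ (fun u => (take (i u) u, drop (i u) u))) => //.
- move=> u v _ _ [e1 e2].
  by rewrite -(cat_take_drop (i u) u) e1 e2 cat_take_drop.
- move=> u ut'; split.
    apply/allpairsP; exists (take (i u) u, drop (i u) u); split => //=;
    by rewrite mem_undup; apply: map_f.
  have [ru _] := tP u ut'.
  rewrite -{1}(cat_take_drop (i u) u) w_cat_le// cat_take_drop//.
- by move=> *; rewrite !mulr_ge0// ltW.
Qed.

(** A letter that can be inserted between a word ending in [p] and a word starting with [linv p] so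
    that nothing cancels; any other generator serves. *)
Let bridge p : {r : letter | r != p & r != linv p}.
Proof.
have other (x : 'I_k) : x != p.1 -> {r : letter | r != p & r != linv p}.
  move=> xp; exists (x, true); first by apply: contraNneq xp => <-.
  by apply: contraNneq xp => -[->].
have [p0|] := eqVneq (Ordinal (ltnW k1)) p.1; last exact: other.
by apply: (other (Ordinal k1)); rewrite -p0.
Qed.

Lemma kernel_sums_unbounded : False.
Proof.
have [c1 c1_gt0 c1P] := large_level.
have [M M0 pwM] := pw_lin.
pose r p := s2val (bridge p).
have rP p : r p != p by exact: (s2valP (bridge p)).
have rP' p : r p != linv p by exact: (s2valP' (bridge p)).
have [B1 B1P] := level 0.
have B0P : sums_bounded (fun u => reduced_word u /\ pw u = 0) w (Num.max B1 1).
  by move=> t ut tP; rewrite le_max B1P.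
have B1_gt0 : 0 < Num.max B1 1 by rewrite lt_max ltr01 orbT.
pose c2 := c1 / (E * Num.max B1 1).
have c2_gt0 : 0 < c2 by rewrite divr_gt0// mulr_gt0.
(* The levels of the joined words: 0 for a plain concatenation, the level of the inserted letter
   otherwise. *)
pose lv := 0 :: [seq pw [:: p] | p : letter].
have [Bl BlP] := levels lv.
(* Inserting the letter [r] costs [E * E / w [:: r]]; the sum over all letters bounds this
   uniformly. *)
pose K := E * E * \sum_(p : letter) (w [:: p])^-1.
have K0 : 0 <= K.
  apply: mulr_ge0; first by rewrite mulr_ge0// ltW.
  by apply: sumr_ge0 => p _; rewrite invr_ge0.
have EK : 0 < E + K by rewrite ltr_wpDr.
(* Chosen so that the two bounds below add up to [(E + K) * e = c2 ^+ 2 / 2], half of the mass of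
   all pairs. *)
pose e := c2 ^+ 2 / (2 * (E + K)).
have e0 : 0 < e by rewrite divr_gt0 ?exprn_gt0// mulr_gt0.
have [m mP] := sums_bounded_tail size BlP e0.
(* A word whose level exceeds [M * m] in absolute value is longer than [m], by [pwM]. *)
have [j [t [jm ut tP tw]]] := c1P (M * m)%N.
have [A [uA AP Aw]] := first_hit_mass B1_gt0 B0P ut tP tw.
(* The inversion is applied to [t] before cutting, because the inverse of a first-hit word need not
   be a first-hit word. *)
have [A' [uA' A'P A'w]] : exists A', [/\ uniq A',
    forall a, a \in A' -> reduced_word a /\ first_hit (- j) a &
    c2 <= \sum_(a <- A') w a].
  apply: (@first_hit_mass _ [seq winv u | u <- t]) => //.
  - by rewrite map_inj_uniq//; exact: can_inj (@winvK k).
  - by move=> _ /mapP[u /tP[ru <-] ->]; rewrite reduced_winv pw_winv.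
  - by rewrite big_map; under eq_bigr do rewrite w_winv.
have big_size a : `|pw a|%N = `|j|%N -> (m < size a)%N.
  move=> aj; rewrite -(ltn_pmul2l M0); apply: leq_trans (pwM a).
  by rewrite aj.
have szA a : a \in A -> (m < size a)%N.
  by move=> /AP[_ [aj _]]; apply: big_size; rewrite aj.
have szA' a : a \in A' -> (m < size a)%N.
  by move=> /A'P[_ [aj _]]; apply: big_size; rewrite aj abszN.
pose P := [seq (a, b) | a <- A, b <- A'].
have uP : uniq P by apply: allpairs_uniq => // -[? ?] [? ?].
have mass : c2 ^+ 2 <= \sum_(x <- P) w x.1 * w x.2.
  rewrite (big_allpairs_dep (h := fun x y : seq letter => (x, y)))/=.
  apply: (@le_trans _ _ ((\sum_(a <- A) w a) * \sum_(b <- A') w b)).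
    by rewrite expr2 ler_pM// ltW.
  by rewrite big_distrlr.
pose good (x : seq letter * seq letter) := reduced_word (x.1 ++ x.2).
(* The joined word determines [a] by [first_hit_inj], and then [b], so the pairs inject into the
   words longer than [m] with level in [lv], of mass at most [e]. *)
have join_bound (Q : pred (seq letter * seq letter))
    (f : seq letter -> seq letter -> seq letter) K' : 0 <= K' ->
    (forall a, injective (f a)) ->
    (forall a b, a \in A -> b \in A' -> Q (a, b) ->
      [/\ reduced_word (a ++ f a b), pw (f a b) + j \in lv &
       w a * w b <= K' * w (a ++ f a b)]) ->
    \sum_(x <- P | Q x) w x.1 * w x.2 <= K' * e.
  move=> K'0 finj fP; rewrite -big_filter; set PQ := [seq _ <- _ | _].
  have PQP x : x \in PQ -> [/\ x.1 \in A, x.2 \in A' & Q (x.1, x.2)].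
    rewrite mem_filter => /andP[Qx /allpairsP[[a b] [/= aA bA' xab]]].
    by move: Qx; rewrite xab.
  apply: (@le_trans _ _ (K' * \sum_(u <- [seq x.1 ++ f x.1 x.2 | x <- PQ]) w u)).
    rewrite big_map big_distrr/= big_seq [leRHS]big_seq.
    by apply: ler_sum => x /PQP[xA xA' Qx]; have [] := fP _ _ xA xA' Qx.
  apply: ler_wpM2l => //; apply: mP.
    rewrite map_inj_in_uniq ?filter_uniq// => -[a b] [a' b'] /PQP[/= aA _ _].
    move=> /PQP[/= a'A _ _] eq_ab.
    have [aa' ff] := first_hit_inj (AP _ aA).2 (AP _ a'A).2 eq_ab.
    by move: ff; rewrite aa' => /finj ->.
  move=> _ /mapP[x /PQP[xA xA' Qx] ->]; have [? ? _] := fP _ _ xA xA' Qx.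
  split; first split => //.
    by rewrite pw_cat (AP _ xA).2.1 addrC.
  by rewrite size_cat (leq_trans (szA _ xA))// leq_addr.
have good_bound : \sum_(x <- P | good x) w x.1 * w x.2 <= E * e.
  apply: (join_bound _ (fun a b => b)) => [|a|a b aA bA' gab]//; first exact: ltW.
  by split; rewrite // (A'P _ bA').2.1 addNr mem_head.
(* Default value for [last]; the words of [A] are nonempty, so it is never returned. *)
have p0 : letter := (Ordinal k1, true).
have bad_bound : \sum_(x <- P | ~~ good x) w x.1 * w x.2 <= K * e.
  apply: (join_bound _ (fun a b => r (last p0 a) :: b)) => [|a|a b aA bA' gab]//.
    by move=> b b' [].
  have [ra _] := AP _ aA; have [rb [pb _]] := A'P _ bA'.
  have := szA _ aA; have := szA' _ bA'; move: gab ra rb pb.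
  case: b {bA'} => // q b; case/lastP: a {aA} => // a l.
  rewrite -[good _]/(reduced_word (rcons a l ++ q :: b)) reduced_rcons_cons.
  rewrite last_rcons => + ra rb pb _ _; rewrite ra rb !andTb negbK => /eqP ql.
  (* The pair is bad exactly when [q = linv l]. Then [r l != linv l] avoids cancellation on the
     left, and [r l != l] on the right. *)
  have rr : reduced_word (rcons a l ++ r l :: q :: b).
    rewrite reduced_rcons_cons ra rP' andTb andbT.
    rewrite -[r l :: _]/(rcons [::] (r l) ++ q :: b) reduced_rcons_cons rb/=.
    by rewrite ql (can_eq (@linvK k)) eq_sym.
  split => //.
    rewrite -cat1s pw_cat pb addrNK inE; apply/orP; right.
    by apply/mapP; exists (r l); rewrite ?mem_enum.
  have h1 := w_cat_ge (rcons a l) [:: r l].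
  have h2 := w_cat_ge (rcons a l ++ [:: r l]) (q :: b).
  rewrite -catA /= in h2.
  have h3 : (w [:: r l])^-1 <= \sum_(p : letter) (w [:: p])^-1.
    rewrite (bigD1 (r l))//= lerDl.
    by apply: sumr_ge0 => p _; rewrite invr_ge0.
  apply: (@le_trans _ _ (E * E * (w [:: r l])^-1 * w (rcons a l ++ r l :: q :: b))).
    rewrite mulrAC ler_pdivlMr// mulrAC -[E * E * _]mulrA.
    apply: le_trans (ler_wpM2l (ltW E_gt0) h2).
    by rewrite mulrA ler_wpM2r.
  by rewrite ler_wpM2r// /K ler_wpM2l// mulr_ge0// ltW.
have : c2 ^+ 2 <= c2 ^+ 2 / 2.
  have -> : c2 ^+ 2 / 2 = E * e + K * e.
    by rewrite /e; field; exact: lt0r_neq0.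
  apply: le_trans mass _; rewrite (bigID good)/=; exact: lerD.
have : 0 < c2 ^+ 2 by exact: exprn_gt0.
lra.
Qed.

End Recurrence.

(** * Isometries of the ball model *)

Section EuclideanNorm.
Variables (R : realType) (n : nat).
Implicit Types (x y z a : 'rV[R]_n) (c : R).

Definition dot x y : R := \sum_i x 0 i * y 0 i.

Lemma enorm_ge0 x : 0 <= enorm x. Proof. exact: sqrtr_ge0. Qed.

Lemma enorm_sqr x : enorm x ^+ 2 = dot x x.
Proof.
rewrite sqr_sqrtr; last by apply: sumr_ge0 => i _; exact: sqr_ge0.
by apply: eq_bigr => i _; rewrite expr2.
Qed.

Lemma dotC x y : dot x y = dot y x.
Proof. by apply: eq_bigr => i _; rewrite mulrC. Qed.

Lemma dotDl x y z : dot (x + y) z = dot x z + dot y z.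
Proof. by rewrite -big_split; apply: eq_bigr => i _; rewrite !mxE mulrDl. Qed.

Lemma dotZl c x y : dot (c *: x) y = c * dot x y.
Proof. by rewrite /dot big_distrr; apply: eq_bigr => i _; rewrite !mxE /= mulrA. Qed.

Lemma enormZ c x : enorm (c *: x) = `|c| * enorm x.
Proof.
apply: (@pexpIrn _ 2) => //; rewrite ?nnegrE ?mulr_ge0 ?enorm_ge0//.
by rewrite exprMn !enorm_sqr dotZl (dotC x) dotZl real_normK ?num_real//; ring.
Qed.

Lemma enormN x : enorm (- x) = enorm x.
Proof. by rewrite -scaleN1r enormZ normrN1 mul1r. Qed.

Lemma enormBC x y : enorm (x - y) = enorm (y - x).
Proof. by rewrite -opprB enormN. Qed.

Lemma enorm0 : enorm (0 : 'rV[R]_n) = 0.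
Proof. by rewrite -(scale0r 0) enormZ normr0 mul0r. Qed.

Lemma enorm_sqrD x y : enorm (x + y) ^+ 2 = enorm x ^+ 2 + 2 * dot x y + enorm y ^+ 2.
Proof. by rewrite !enorm_sqr !dotDl ![dot _ (x + y)]dotC !dotDl (dotC y x); ring. Qed.

Lemma enorm_sqrB x y : enorm (x - y) ^+ 2 = enorm x ^+ 2 - 2 * dot x y + enorm y ^+ 2.
Proof. by rewrite enorm_sqrD enormN dotC -scaleN1r dotZl dotC; ring. Qed.

Lemma coord_le_enorm x i : `|x 0 i| <= enorm x.
Proof.
rewrite -sqrtr_sqr ler_wsqrtr// (bigD1 i)//= lerDl.
by apply: sumr_ge0 => j _; exact: sqr_ge0.
Qed.

Lemma enorm_eq0 x : enorm x = 0 -> x = 0.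
Proof.
move=> x0; apply/rowP => i; apply/eqP; rewrite mxE -normr_le0 -x0.
exact: coord_le_enorm.
Qed.

(** Cauchy-Schwarz, from expanding the squared norm of [enorm y ^+ 2 *: x - dot x y *: y]. *)
Lemma dot_le x y : dot x y <= enorm x * enorm y.
Proof.
have [y0|y0] := eqVneq (enorm y) 0.
  rewrite y0 mulr0 /dot big1// => i _; rewrite (enorm_eq0 y0) mxE mulr0//.
have yp : 0 < enorm y by rewrite lt_def y0 enorm_ge0.
have := sqr_ge0 (enorm (enorm y ^+ 2 *: x - dot x y *: y)).
rewrite enorm_sqrB !enormZ dotZl dotC dotZl (dotC y x).
rewrite !exprMn !real_normK ?num_real// => h.
have : 0 <= enorm y ^+ 2 * ((enorm x * enorm y) ^+ 2 - dot x y ^+ 2).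
  apply: le_trans h _; rewrite le_eqVlt; apply/orP; left; apply/eqP; ring.
rewrite pmulr_rge0 ?exprn_gt0// subr_ge0 => le2.
rewrite real_leNgt ?num_real//; apply/negP => lt.
have : 0 <= enorm x * enorm y by rewrite mulr_ge0 ?enorm_ge0.
nra.
Qed.

Lemma enormD x y : enorm (x + y) <= enorm x + enorm y.
Proof.
rewrite -(@ler_pXn2r _ 2) ?nnegrE ?addr_ge0 ?enorm_ge0// enorm_sqrD.
have := dot_le x y; nra.
Qed.

Lemma enorm_dist_triangle z x y : enorm (x - y) <= enorm (x - z) + enorm (z - y).
Proof. by rewrite -{1}(subrK z x) -addrA enormD. Qed.

Lemma norm_le_enorm x : `|x| <= enorm x.
Proof.
rewrite [leLHS]/Num.norm/= mx_normrE; apply/bigmax_leP; split; first exact: enorm_ge0.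
by move=> [i j] _ /=; rewrite (ord1 i); exact: coord_le_enorm.
Qed.

Lemma enorm_le_norm x : enorm x <= n%:R * `|x|.
Proof.
rewrite -(@ler_pXn2r _ 2) ?nnegrE ?mulr_ge0 ?enorm_ge0// enorm_sqr exprMn.
have xi i : x 0 i * x 0 i <= `|x| ^+ 2.
  rewrite -expr2 -[leLHS]real_normK ?num_real// ler_pXn2r ?nnegrE//.
  rewrite [leRHS]/Num.norm/= mx_normrE.
  exact: (le_bigmax _ (fun ij : 'I_1 * 'I_n => `|x ij.1 ij.2|) (0, i)).
apply: (@le_trans _ _ (\sum_(i < n) `|x| ^+ 2)); first exact: ler_sum.
rewrite sumr_const card_ord -[leLHS]mulr_natl ler_wpM2r ?sqr_ge0//.
by rewrite -natrX ler_nat expnS expn1; case: (n) => // m; rewrite leq_pmulr.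
Qed.

End EuclideanNorm.

(** * Distortion and displacement of isometries of the ball *)

Section Isometries.
Variables (R : realType) (n : nat).
Implicit Types (x y a : 'rV[R]_n) (g h : hisom R n) (p q : hspace R n).
Local Notation o := (horigin R n).

Definition conf x : R := 1 - enorm x ^+ 2.
(** This is [sinh^2 (d / 2)] for the hyperbolic distance [d]. *)
Definition mdist x y : R := enorm (x - y) ^+ 2 / (conf x * conf y).
(* [moebden x a = |1 - x * conj a|^2] in complex notation *)
Definition moebden x a : R := 1 - 2 * dot x a + enorm x ^+ 2 * enorm a ^+ 2.

Lemma hspaceP p : enorm (\val p) < 1.
Proof. by case: p => x /= /set_mem. Qed.

Lemma conf_gt0 p : 0 < conf (\val p).
Proof. by rewrite subr_gt0 expr_lt1 ?enorm_ge0// hspaceP. Qed.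

Lemma conf_le1 x : conf x <= 1.
Proof. by rewrite gerBl sqr_ge0. Qed.

Lemma conf0 : conf 0 = 1. Proof. by rewrite /conf enorm0 expr0n subr0. Qed.

Lemma mdist_ge0 p q : 0 <= mdist (\val p) (\val q).
Proof. by rewrite divr_ge0 ?sqr_ge0// mulr_ge0 ?ltW ?conf_gt0. Qed.

(** The argument [e] of the logarithm determines [r], since [e + e^-1 = 2 * r]. *)
Lemma arcosh_inj (s t : R) : 1 <= s -> 1 <= t -> arcosh s = arcosh t -> s = t.
Proof.
have pos (r : R) : 1 <= r -> 0 < r + Num.sqrt (r ^+ 2 - 1).
  by move=> r1; rewrite ltr_wpDr ?sqrtr_ge0//; lra.
have rec (r : R) : 1 <= r ->
    (r + Num.sqrt (r ^+ 2 - 1)) + (r + Num.sqrt (r ^+ 2 - 1))^-1 = 2 * r.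
  move=> r1; have r0 := pos r r1.
  suff -> : (r + Num.sqrt (r ^+ 2 - 1))^-1 = r - Num.sqrt (r ^+ 2 - 1) by ring.
  apply: (mulIf (lt0r_neq0 r0)); rewrite mulVf ?lt0r_neq0//.
  by rewrite -subr_sqr sqr_sqrtr; [ring | nra].
move=> s1 t1 /ln_inj e; have := rec s s1.
rewrite e ?posrE ?pos// rec//; lra.
Qed.

Lemma mdist_isom g p q : mdist (\val (g p)) (\val (g q)) = mdist (\val p) (\val q).
Proof.
have hdistE (p' q' : hspace R n) :
    hdist p' q' = arcosh (1 + 2 * mdist (\val p') (\val q')).
  by rewrite /hdist -mulrA.
have := @hmap_isom R n g p q; rewrite !hdistE.
have ge1 (p' q' : hspace R n) : 1 <= 1 + 2 * mdist (\val p') (\val q').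
  by rewrite lerDl mulr_ge0// mdist_ge0.
by move=> e; have := arcosh_inj (ge1 _ _) (ge1 _ _) e; lra.
Qed.

Lemma hisomK g p : g ((g^-1)%g p) = p.
Proof. exact: (congr1 (fun f : hisom R n => f p) (mulgV g)). Qed.

Lemma moebdenE x a : conf x * conf a + enorm (x - a) ^+ 2 = moebden x a.
Proof. by rewrite enorm_sqrB /conf /moebden; ring. Qed.

Lemma moebden_ge x a : (1 - enorm x * enorm a) ^+ 2 <= moebden x a.
Proof. by have := dot_le x a; rewrite /moebden; nra. Qed.

Lemma moebden_le4 p q : moebden (\val p) (\val q) <= 4.
Proof.
have := dot_le (- \val p) (\val q); rewrite enormN -scaleN1r dotZl.
have := hspaceP p; have := hspaceP q; have := enorm_ge0 (\val p).
have := enorm_ge0 (\val q); rewrite /moebden.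
move: (enorm _) (enorm _) (dot _ _) => s t u s0 t0 s1 t1 h.
have : t * s <= 1 by rewrite mulr_ile1// ltW.
have : 0 <= t * s by rewrite mulr_ge0.
nra.
Qed.

(** Take [a] with [g a = o] and compare [mdist] of [p, a] with that of [g p, o]. Adding 1 to both
    sides turns them into [moebden / (conf p * conf a)] and [1 / conf (g p)]. *)
Lemma conf_isom g p : conf (\val (g p)) * moebden (\val p) (\val ((g^-1)%g o)) =
  conf (\val p) * conf (\val ((g^-1)%g o)).
Proof.
set a := (g^-1)%g o.
have := mdist_isom g p a; rewrite /a hisomK -/a /mdist subr0 conf0 mulr1.
have c1 := conf_gt0 (g p); have c2 := conf_gt0 p; have c3 := conf_gt0 a.
move=> e; rewrite -moebdenE.
have -> : enorm (\val p - \val a) ^+ 2 =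
    enorm (\val (g p)) ^+ 2 / conf (\val (g p)) * (conf (\val p) * conf (\val a)).
  by rewrite e divfK// mulf_neq0// lt0r_neq0.
have -> : enorm (\val (g p)) ^+ 2 = 1 - conf (\val (g p)) by rewrite /conf; ring.
field; exact: lt0r_neq0.
Qed.

Lemma conf_origin_inv g : conf (\val ((g^-1)%g o)) = conf (\val (g o)).
Proof.
have := conf_isom g o; rewrite conf0 mul1r => <-.
rewrite /moebden enorm0 /dot big1 ?mulr0 ?expr0n ?mul0r ?subr0 ?addr0 ?mulr1//.
by move=> i _; rewrite mxE mul0r.
Qed.

(* [dil g = cosh^2 (d / 2)] where [d] is the distance from [o] to [g o] *)
Definition dil g : R := (conf (\val (g o)))^-1.

Lemma dil_gt0 g : 0 < dil g. Proof. by rewrite invr_gt0 conf_gt0. Qed.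

Lemma dil_ge1 g : 1 <= dil g. Proof. by rewrite invf_ge1 ?conf_gt0// conf_le1. Qed.

Lemma dilV g : dil (g^-1)%g = dil g.
Proof. by rewrite /dil conf_origin_inv. Qed.

Lemma dilM g h :
  dil (g * h)%g = moebden (\val (h o)) (\val ((g^-1)%g o)) * dil g * dil h.
Proof.
have := conf_isom g (h o); rewrite conf_origin_inv /dil => e.
have c1 := conf_gt0 (g (h o)); have c2 := conf_gt0 (h o); have c3 := conf_gt0 (g o).
have -> : moebden (\val (h o)) (\val ((g^-1)%g o)) =
   conf (\val (h o)) * conf (\val (g o)) / conf (\val (g (h o))).
  by rewrite -e mulrC mulKf// lt0r_neq0.
rewrite -[((g * h)%g) o]/(g (h o)); field.
by rewrite !lt0r_neq0.
Qed.

Lemma dilM_le g h : dil (g * h)%g <= 4 * dil g * dil h.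
Proof.
have d := dil_gt0; rewrite dilM.
by apply: ler_wpM2r; [exact: ltW | apply: ler_wpM2r; [exact: ltW | exact: moebden_le4]].
Qed.

(** The source of all lower bounds on displacement: by [moebdenE] the factor in [dilM] is at least
    the squared Euclidean distance between [h o] and [g^-1 o]. *)
Lemma dilM_ge g h (e : R) : 0 <= e -> e <= enorm (\val (h o) - \val ((g^-1)%g o)) ->
  e ^+ 2 * (dil g * dil h) <= dil (g * h)%g.
Proof.
move=> e0 le; rewrite dilM -mulrA; apply: ler_wpM2r.
  by rewrite mulr_ge0// ltW// dil_gt0.
rewrite -moebdenE; apply: (@le_trans _ _ (enorm (\val (h o) - \val ((g^-1)%g o)) ^+ 2)).
  by rewrite ler_pXn2r ?nnegrE ?enorm_ge0.
by rewrite lerDr mulr_ge0// ltW// conf_gt0.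
Qed.

(** With [t] the norm of [g^-1 o], the denominator in [conf_isom] is at least [(1 - t)^2]. So [conf]
    grows at most by the factor [(1 + t) / (1 - t) = (1 + t)^2 * dil g]. *)
Lemma conf_isom_le g p : conf (\val (g p)) <= 4 * dil g * conf (\val p).
Proof.
have := conf_isom g p; set a := (g^-1)%g o => e.
have := moebden_ge (\val p) (\val a); have := hspaceP p; have := hspaceP a.
have := conf_gt0 (g p); have := conf_gt0 p; have := conf_gt0 a.
have := enorm_ge0 (\val a); have := enorm_ge0 (\val p).
move: e; rewrite /dil -conf_origin_inv -/a.
move: (moebden _ _) (conf (\val (g p))) (conf (\val p)) => D c' c.
rewrite /conf; move: (enorm (\val p)) (enorm (\val a)) => s t e s0 t0 ca cc cc' t1 s1 D1.
have st : s * t <= t by rewrite ler_piMl// ltW.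
have D2 : (1 - t) ^+ 2 <= D.
  by apply: le_trans D1; rewrite ler_pXn2r ?nnegrE//; lra.
rewrite mulrAC ler_pdivlMr//.
have t10 : 0 < 1 - t by lra.
rewrite -(ler_pM2r t10); apply: (@le_trans _ _ (c' * D * (1 + t))).
  have : c' * (1 - t) ^+ 2 <= c' * D by rewrite ler_wpM2l// ltW.
  nra.
rewrite e; have -> : c * (1 - t ^+ 2) * (1 + t) = c * (1 - t) * (1 + t) ^+ 2 by ring.
have -> : 4 * c * (1 - t) = c * (1 - t) * 4 by ring.
apply: ler_wpM2l; [by rewrite mulr_ge0// ltW | nra].
Qed.

(** Invariance of [mdist] expresses the squared ratio of distances as a product of two conformal
    ratios, each bounded by [conf_isom_le]. *)
Lemma isom_lipschitz g p q :
  enorm (\val (g p) - \val (g q)) <= 4 * dil g * enorm (\val p - \val q).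
Proof.
have := mdist_isom g p q; rewrite /mdist => e.
have c1 := conf_gt0 (g p); have c2 := conf_gt0 p; have d := dil_gt0 g.
have c3 := conf_gt0 (g q); have c4 := conf_gt0 q.
rewrite -(@ler_pXn2r _ 2) ?nnegrE ?mulr_ge0 ?enorm_ge0 ?(ltW d)// exprMn.
have -> : enorm (\val (g p) - \val (g q)) ^+ 2 =
    enorm (\val p - \val q) ^+ 2 / (conf (\val p) * conf (\val q)) *
    (conf (\val (g p)) * conf (\val (g q))).
  by rewrite -e divfK// mulf_neq0// lt0r_neq0.
rewrite mulrAC ler_pdivrMr ?mulr_gt0//.
set X := enorm _ ^+ 2.
have -> : (4 * dil g) ^+ 2 * X * (conf (\val p) * conf (\val q)) =
  X * ((4 * dil g * conf (\val p)) * (4 * dil g * conf (\val q))) by ring.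
apply: ler_wpM2l; first exact: sqr_ge0.
exact: ler_pM (ltW c1) (ltW c3) (conf_isom_le g p) (conf_isom_le g q).
Qed.

(** Points away from [g^-1 o] are sent near [g o]. Apply invariance of [mdist] to [p, o], then
    [conf_isom] with [moebden] at least the squared distance from [p] to [g^-1 o]. *)
Lemma isom_shadow g p :
  enorm (\val (g p) - \val (g o)) * enorm (\val p - \val ((g^-1)%g o)) <=
  conf (\val (g o)).
Proof.
have c1 := conf_gt0 (g p); have c2 := conf_gt0 p; have c3 := conf_gt0 (g o).
have := mdist_isom g p o; rewrite /mdist subr0 conf0 mulr1 => e.
have cf := conf_isom g p; rewrite conf_origin_inv in cf.
rewrite -(@ler_pXn2r _ 2) ?nnegrE ?mulr_ge0 ?enorm_ge0 ?(ltW c3)// exprMn.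
have -> : enorm (\val (g p) - \val (g o)) ^+ 2 =
   enorm (\val p) ^+ 2 / conf (\val p) * (conf (\val (g p)) * conf (\val (g o))).
  by rewrite -e divfK// mulf_neq0// lt0r_neq0.
apply: (@le_trans _ _ (enorm (\val p) ^+ 2 / conf (\val p) *
   (conf (\val (g p)) * conf (\val (g o))) * moebden (\val p) (\val ((g^-1)%g o)))).
  apply: ler_wpM2l; last by rewrite -moebdenE lerDr mulr_ge0// ltW// conf_gt0.
  by apply: mulr_ge0; [apply: divr_ge0; rewrite ?sqr_ge0// ltW
    | rewrite mulr_ge0// ltW].
have -> : enorm (\val p) ^+ 2 / conf (\val p) *
   (conf (\val (g p)) * conf (\val (g o))) * moebden (\val p) (\val ((g^-1)%g o)) =
   enorm (\val p) ^+ 2 / conf (\val p) * conf (\val (g o)) *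
   (conf (\val (g p)) * moebden (\val p) (\val ((g^-1)%g o))) by ring.
rewrite cf; have -> : enorm (\val p) ^+ 2 / conf (\val p) * conf (\val (g o)) *
  (conf (\val p) * conf (\val (g o))) = enorm (\val p) ^+ 2 * conf (\val (g o)) ^+ 2.
  by field; exact: lt0r_neq0.
by rewrite ler_piMl ?sqr_ge0// expr_le1 ?enorm_ge0// ltW// hspaceP.
Qed.

Definition odist g : R := hdist o (g o).

Lemma odist_cosh g : odist g = arcosh (2 * dil g - 1).
Proof.
rewrite /odist /hdist sub0r enormN enorm0 expr0n subr0 mul1r -/(conf _) /dil.
have c := conf_gt0 (g o); congr arcosh.
have -> : enorm (\val (g o)) ^+ 2 = 1 - conf (\val (g o)) by rewrite /conf; ring.
field; exact: lt0r_neq0.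
Qed.

(** Up to an additive constant [odist] is [ln (dil g)], so multiplicative bounds on [dil] become
    additive bounds on [odist]. *)
Lemma expR_odist g : dil g <= expR (odist g) <= 4 * dil g.
Proof.
rewrite odist_cosh /arcosh; have := dil_ge1 g; move: (dil g) => D D1.
have s0 := sqrtr_ge0 ((2 * D - 1) ^+ 2 - 1).
have s1 : Num.sqrt ((2 * D - 1) ^+ 2 - 1) <= 2 * D - 1.
  rewrite -[leRHS]ger0_norm -?sqrtr_sqr ?ler_wsqrtr//; last lra.
  by rewrite gerBl.
by rewrite lnK ?posrE; lra.
Qed.

Lemma odist_ge0 g : 0 <= odist g.
Proof.
rewrite -ler_expR expR0; have /andP[+ _] := expR_odist g.
exact: le_trans (dil_ge1 g).
Qed.

Lemma odistV g : odist (g^-1)%g = odist g.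
Proof. by rewrite !odist_cosh dilV. Qed.

(** A triangle inequality with an additive error, read off [dilM_le]: one factor 4 comes from there
    and one from [expR_odist]. *)
Lemma odistM g h : odist (g * h)%g <= odist g + odist h + ln 16.
Proof.
have p16 : expR (ln (16 : R)) = 16 by rewrite lnK// posrE.
rewrite -ler_expR !expRD {}p16.
have /andP[_] := expR_odist (g * h)%g; have /andP[a _] := expR_odist g.
have /andP[b _] := expR_odist h; have := dilM_le g h.
have := ler_pM (ltW (dil_gt0 g)) (ltW (dil_gt0 h)) a b; move=> {a b}.
move: (dil g) (dil h) (dil (g * h)%g) => x y z.
move: (expR (odist (g * h)%g)) (expR (odist g)) (expR (odist h)) => u v w.
by lra.
Qed.

Lemma odistM_ge g h (e : R) : 0 < e ->
  e <= enorm (\val (h o) - \val ((g^-1)%g o)) ->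
  odist g + odist h <= odist (g * h)%g + ln (16 / e ^+ 2).
Proof.
move=> e0 /(dilM_ge (ltW e0)).
have : 0 < e ^+ 2 by rewrite exprn_gt0.
move: (e ^+ 2) => e2 e2_gt0 le.
have p16 : expR (ln (16 / e2)) = 16 / e2 by rewrite lnK// posrE divr_gt0.
rewrite -ler_expR !expRD {}p16; move: le.
have /andP[+ _] := expR_odist (g * h)%g.
have /andP[_ b] := expR_odist g; have /andP[_ c] := expR_odist h.
have := ler_pM (expR_ge0 _) (expR_ge0 _) b c; move=> {b c}.
move: (dil g) (dil h) (dil (g * h)%g) => x y z.
move: (expR (odist (g * h)%g)) (expR (odist g)) (expR (odist h)) => u v w.
move=> le1 le2 le3; rewrite mulrA ler_pdivlMr//.
have : v * w * e2 <= 4 * x * (4 * y) * e2 by rewrite ler_pM2r.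
lra.
Qed.

End Isometries.

(** * Extension to the sphere at infinity *)

Section Boundary.
Variables (R : realType) (n : nat).
Implicit Types (x y a : 'rV[R]_n) (g h : hisom R n) (p q : hspace R n).
Implicit Types (xi zeta : hsphere R n).
Local Notation o := (horigin R n).

Lemma hsphereP xi : enorm (\val xi) = 1.
Proof. by case: xi => x /= /set_mem. Qed.

Lemma nbhs_enorm x (U : set 'rV[R]_n) :
  nbhs x U <-> exists2 e : R, 0 < e & forall y, enorm (y - x) < e -> U y.
Proof.
split=> [/nbhs_ballP[e /= e0 eU]|[e e0 eU]].
  exists e => // y ye; apply: eU; rewrite mx_norm_ball /ball_/= distrC.
  exact: le_lt_trans (norm_le_enorm _) ye.
apply/nbhs_ballP; exists (e / n.+1%:R) => /=; first by rewrite divr_gt0.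
move=> y; rewrite mx_norm_ball /ball_/= distrC ltr_pdivlMr// => ye.
apply: eU; apply: le_lt_trans (enorm_le_norm _) _; apply: le_lt_trans ye.
by rewrite mulrC ler_wpM2l// ler_nat.
Qed.

Lemma sphere_approx xi (d : R) : 0 < d -> exists p, enorm (\val p - \val xi) < d.
Proof.
move=> d0; pose e := Num.min (d / 2) 1.
have e0 : 0 < e by rewrite lt_min divr_gt0//=.
have e1 : e <= 1 by rewrite ge_min lexx orbT.
have ed : e < d.
  by rewrite /e gt_min; apply/orP; left; rewrite ltr_pdivrMr//; lra.
have hp : (1 - e) *: \val xi \in hspace R n.
  rewrite inE /hspace/= enormZ hsphereP mulr1 ger0_norm; lra.
exists (exist (fun x => x \in hspace R n) _ hp) => /=.
rewrite scalerBl scale1r addrAC subrr sub0r enormN enormZ hsphereP mulr1.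
by rewrite ger0_norm// ltW.
Qed.

(** Carries inequalities from the ball to the sphere: an error linear in the distance to [xi]
    disappears in the limit. *)
Lemma le0_sphere_approx xi (c K : R) :
  (forall p, c <= K * enorm (\val p - \val xi)) -> c <= 0.
Proof.
move=> cK; rewrite leNgt; apply/negP => c0.
have d0 : 0 < c / (`|K| + 1) by rewrite divr_gt0// ltr_wpDl.
have [p pd] := sphere_approx xi d0; have := cK p; apply/negP; rewrite -ltNge.
rewrite ltr_pdivlMr in pd; last by rewrite ltr_wpDl.
apply: le_lt_trans pd; rewrite mulrC ler_wpM2l ?enorm_ge0//.
by have := ler_norm K; lra.
Qed.

Let F xi := filter_from (nbhs (\val xi))
  (fun U => [set p : hspace R n | U (\val p)]).

Let F_proper xi : ProperFilter (F xi).
Proof.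
apply: filter_from_proper => [|U /nbhs_enorm[e e0 eU]]; last first.
  by have [p pe] := sphere_approx xi e0; exists p; exact: eU.
apply: filter_from_filter; first by exists setT; exact: filterT.
by move=> U V xU xV; exists (U `&` V) => //; exact: filterI.
Qed.

Let F_near xi (e : R) : 0 < e -> F xi [set p | enorm (\val p - \val xi) < e].
Proof.
move=> e0; exists [set y | enorm (y - \val xi) < e] => //.
by apply/nbhs_enorm; exists e.
Qed.

(** The Lipschitz bound makes the image filter Cauchy, and the space is complete. *)
Let lim_hboundary g xi : (fun p => \val (g p)) @ F xi --> hboundary g xi.
Proof.
have FF := F_proper xi.
apply: cauchy_cvg; apply: cauchy_exP => e e0.
have K0 : 0 < 8 * dil g by rewrite mulr_gt0// dil_gt0.
have d0 : 0 < e / (8 * dil g) by rewrite divr_gt0.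
have [p pd] := sphere_approx xi d0.
exists (\val (g p)); apply: (@filterS _ (F xi)) (F_near xi d0).
move=> q /= qd; rewrite mx_norm_ball /ball_/=.
apply: le_lt_trans (norm_le_enorm _) _; apply: le_lt_trans (isom_lipschitz _ _ _) _.
have := enorm_dist_triangle (\val xi) (\val p) (\val q).
rewrite (enormBC (\val xi)) => le.
rewrite ltr_pdivlMr// in pd; rewrite ltr_pdivlMr// in qd.
have := ler_wpM2l (ltW K0) le; lra.
Qed.

Lemma hboundary_lipschitz g xi p :
  enorm (\val (g p) - hboundary g xi) <= 4 * dil g * enorm (\val p - \val xi).
Proof.
apply/ler_addgt0Pr => e e0; have FF := F_proper xi.
have K0 : 0 < 4 * dil g by rewrite mulr_gt0// dil_gt0.
have : F xi [set q | enorm (\val (g q) - hboundary g xi) < e / 2].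
  apply: (@lim_hboundary g xi [set y | enorm (y - hboundary g xi) < e / 2]).
  by apply/nbhs_enorm; exists (e / 2) => //; rewrite divr_gt0.
have d0 : 0 < e / 2 / (4 * dil g) by rewrite divr_gt0// divr_gt0.
move=> /(@filterI _ (F xi) _ _ _ (F_near xi d0)) /filter_ex[q /= [qd ge]].
rewrite ltr_pdivlMr// in qd.
have := enorm_dist_triangle (\val (g q)) (\val (g p)) (hboundary g xi).
have := isom_lipschitz g p q.
have := enorm_dist_triangle (\val xi) (\val p) (\val q).
rewrite (enormBC (\val xi)) => /(ler_wpM2l (ltW K0)).
lra.
Qed.

(** Identifies a boundary value through a linear estimate alone, which gives the action laws below
    with no further limits. *)
Lemma hboundary_unique g xi y K :
  (forall p, enorm (\val (g p) - y) <= K * enorm (\val p - \val xi)) ->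
  hboundary g xi = y.
Proof.
move=> yK; apply/eqP; rewrite -subr_eq0; apply/eqP/enorm_eq0/eqP.
rewrite eq_le enorm_ge0 andbT; apply: (@le0_sphere_approx xi _ (4 * dil g + K)) => p.
apply: le_trans (enorm_dist_triangle (\val (g p)) _ _) _.
by rewrite mulrDl lerD// enormBC hboundary_lipschitz.
Qed.

Lemma enorm_dist x y : `|enorm x - enorm y| <= enorm (x - y).
Proof.
rewrite ler_norml; have := enormD (x - y) y; have := enormD (y - x) x.
rewrite !subrK (enormBC y); lra.
Qed.

(** As [p] tends to [xi], [conf_isom_le] drives [conf (g p)] to 0. The constant 12 is 4 from the
    Lipschitz bound plus 8 from this one. *)
Lemma enorm_hboundary g xi : enorm (hboundary g xi) = 1.
Proof.
have d0 := dil_gt0 g.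
apply/esym/eqP; rewrite -subr_eq0 -normr_le0.
apply: (@le0_sphere_approx xi _ (12 * dil g)) => p.
have := enorm_dist (\val (g p)) (hboundary g xi).
move=> /le_trans/(_ (hboundary_lipschitz g xi p)).
have := conf_isom_le g p; have := hspaceP (g p); have := hspaceP p.
have := enorm_dist (\val p) (\val xi); rewrite hsphereP /conf.
have := enorm_ge0 (\val p); have := enorm_ge0 (\val (g p)).
move: (enorm (\val (g p))) (enorm (\val p)) (enorm (hboundary g xi)) => s t u.
move: (enorm _) => d s0 t0 + t1 s1 h1 h2; rewrite !ler_norml => h3.
have h4 : dil g * (1 - t) <= dil g * d by rewrite ler_pM2l//; lra.
have h5 : 1 - s <= 8 * dil g * d.
  have : 1 - t ^+ 2 <= 2 * (1 - t) by nra.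
  move=> /(ler_wpM2l (ltW d0)); have : 1 - s <= 1 - s ^+ 2 by nra.
  lra.
move: h2; rewrite ler_norml; lra.
Qed.

Lemma hboundary_in g xi : hboundary g xi \in hsphere R n.
Proof. by rewrite inE /hsphere/= enorm_hboundary. Qed.

Definition bnd g xi : hsphere R n :=
  exist (fun x => x \in hsphere R n) _ (hboundary_in g xi).

Lemma bndM g h xi : bnd (g * h)%g xi = bnd g (bnd h xi).
Proof.
apply: val_inj; apply: (@hboundary_unique _ _ _ (4 * dil g * (4 * dil h))) => p.
rewrite -[(g * h)%g p]/(g (h p)).
apply: le_trans (hboundary_lipschitz g (bnd h xi) (h p)) _.
rewrite -[leRHS]mulrA; apply: ler_wpM2l; last exact: hboundary_lipschitz.
by rewrite mulr_ge0// ltW// dil_gt0.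
Qed.

Lemma bnd1 xi : bnd 1%g xi = xi.
Proof. by apply: val_inj; apply: (@hboundary_unique _ _ _ 1) => p; rewrite mul1r. Qed.

Lemma bndK g xi : bnd (g^-1)%g (bnd g xi) = xi.
Proof. by rewrite -bndM mulVg bnd1. Qed.

Lemma bndVK g xi : bnd g (bnd (g^-1)%g xi) = xi.
Proof. by rewrite -bndM mulgV bnd1. Qed.

(** The limit of [isom_shadow] as [p] tends to [xi]; [key] collects the errors of the four
    replacements into one linear term. *)
Lemma bnd_shadow g xi :
  enorm (\val (bnd g xi) - \val (g o)) * enorm (\val xi - \val ((g^-1)%g o)) <=
  conf (\val (g o)).
Proof.
have d0 := dil_gt0 g.
have key (A B X Y L e d c : R) : 0 < d -> 0 <= A -> 0 <= B -> 0 <= Y -> 0 <= L ->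
    0 <= e -> A * B <= c -> L <= 4 * d * e -> X <= L + A -> Y <= e + B ->
    A <= 2 -> B <= 2 -> e <= 2 -> X * Y - c <= (16 * d + 2) * e.
  move=> d1 A0 B0 Y0 L0 e0 ABc Le XLA YeB A2 B2 e2.
  have k1 : X * Y <= (L + A) * Y by rewrite ler_wpM2r.
  have k2 : (L + A) * Y <= (L + A) * (e + B) by rewrite ler_wpM2l// addr_ge0.
  have k3 : L * e <= L * 2 by rewrite ler_wpM2l.
  have k4 : L * B <= L * 2 by rewrite ler_wpM2l.
  have k5 : A * e <= 2 * e by rewrite ler_wpM2r.
  lra.
rewrite -subr_le0; apply: (@le0_sphere_approx xi _ (16 * dil g + 2)) => p.
have h1 := isom_shadow g p; have h2 := hboundary_lipschitz g xi p.
have h3 := enorm_dist_triangle (\val (g p)) (\val (bnd g xi)) (\val (g o)).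
have h4 := enorm_dist_triangle (\val p) (\val xi) (\val ((g^-1)%g o)).
have le2 x y : enorm x <= 1 -> enorm y <= 1 -> enorm (x - y) <= 2.
  by move=> x1 y1; apply: le_trans (enormD _ _) _; rewrite enormN; lra.
have h5 : enorm (\val (g p) - \val (g o)) <= 2 by apply: le2; rewrite ltW ?hspaceP.
have h6 : enorm (\val p - \val ((g^-1)%g o)) <= 2.
  by apply: le2; rewrite ltW ?hspaceP.
have h7 : enorm (\val p - \val xi) <= 2.
  by apply: le2; rewrite ?hsphereP// ltW ?hspaceP.
rewrite (enormBC (\val (bnd g xi)) (\val (g p))) in h3.
rewrite (enormBC (\val xi) (\val p)) in h4.
exact: key d0 (enorm_ge0 _) (enorm_ge0 _) (enorm_ge0 _) (enorm_ge0 _)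
  (enorm_ge0 _) h1 h2 h3 h4 h5 h6 h7.
Qed.

Lemma bnd_lipschitz g xi zeta :
  enorm (\val (bnd g xi) - \val (bnd g zeta)) <= 4 * dil g * enorm (\val xi - \val zeta).
Proof.
have d0 := dil_gt0 g; rewrite -subr_le0.
apply: (@le0_sphere_approx xi _ (8 * dil g)) => p.
have := enorm_dist_triangle (\val (g p)) (\val (bnd g xi)) (\val (bnd g zeta)).
rewrite (enormBC (\val (bnd g xi)) (\val (g p))) => h1.
rewrite lerBlDr; apply: le_trans h1 _.
apply: le_trans (lerD (hboundary_lipschitz g xi p) (hboundary_lipschitz g zeta p)) _.
have K0 : 0 <= 4 * dil g by rewrite mulr_ge0// ltW.
have := ler_wpM2l K0 (enorm_dist_triangle (\val xi) (\val p) (\val zeta)).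
move: (enorm (\val p - \val xi)) (enorm (\val p - \val zeta)) => x y.
by move: (enorm (\val xi - \val zeta)) => z; lra.
Qed.

End Boundary.

(** * Compactness of topological balls *)

Lemma finite_lower_bound (R : realType) (T : finType) (P : T -> R -> Prop) :
  (forall t e e', P t e -> e' <= e -> P t e') ->
  (forall t, exists2 e, 0 < e & P t e) ->
  exists2 e, 0 < e & forall t, P t e.
Proof.
move=> Ple Pex.
have [f fP] := choice (fun t => let: ex_intro2 e e0 Pe := Pex t in
  ex_intro (fun e => 0 < e /\ P t e) e (conj e0 Pe)).
exists (\big[Num.min/1]_t f t).
  by apply: lt_bigmin => // t _; have [] := fP t.
move=> t; have [_ Pt] := fP t; apply: Ple Pt _; exact: bigmin_le.
Qed.

Lemma compact_set_type (T : topologicalType) (A : set T) :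
  compact A -> compact [set: set_type A].
Proof.
move=> cA F FF _.
have FA : ((@set_val T A) @ F) A.
  by apply: (@filterS _ F _ setT) filterT => x _; exact: set_valP.
have [a [Aa acl]] := cA ((@set_val T A) @ F) _ FA.
exists (exist (fun x => x \in A) a (mem_set Aa)); split => // B U FB.
rewrite nbhsE => -[V [[W oW WV] Va] VU].
have FB' : ((@set_val T A) @ F) (set_val @` B).
  by apply: (@filterS _ F) FB => x Bx; exists x.
have aW : nbhs a W by apply: open_nbhs_nbhs; split => //; move: Va; rewrite -WV.
have [_ [[b Bb <-] Wb]] := acl _ _ FB' aW.
by exists b; split => //; apply: VU; rewrite -WV.
Qed.

Lemma compact_image_set_type (T : topologicalType) (X : topologicalType) (A : set T)
    (f : T -> X) : compact A -> continuous f -> compact (f @` A).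
Proof. by move=> cA cf; apply: continuous_compact => //; exact: continuous_subspaceT. Qed.

Lemma cball_compact (R : realType) (n : nat) : compact (cball R n).
Proof.
apply: bounded_closed_compact.
  exists 1; split => // M M1 x x1; apply: le_trans (norm_le_enorm x) _.
  exact: le_trans x1 (ltW M1).
move=> x xcl; apply/ler_addgt0Pr => e e0.
have [|y [y1 yx]] := xcl [set y | enorm (y - x) < e].
  by apply/nbhs_enorm; exists e.
have := enorm_dist x y; rewrite enormBC => /le_trans/(_ (ltW yx)).
by rewrite ler_norml; move: y1; rewrite /cball/=; lra.
Qed.

Section TopologicalBalls.
Variables (R : realType) (n : nat).

Lemma topological_cball_compact (D : set (hsphere R n)) :
  topological_cball D -> compact [set \val x | x in D].
Proof.
move=> [f [h [cf ch fK hK]]].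
pose F (z : set_type (cball R n.-1)) : 'rV[R]_n := set_val (set_val (f z)).
have -> : [set \val x | x in D] = F @` setT.
  apply/seteqP; split=> [_ [x Dx <-]|_ [z _ <-]].
    exists (h (exist (fun y => y \in D) x (mem_set Dx))) => //.
    by rewrite /F hK.
  by exists (set_val (f z)) => //; exact: set_valP.
apply: compact_image_set_type; first exact/compact_set_type/cball_compact.
move=> z; apply: (@continuous_comp _ _ _ (fun z => set_val (f z)) set_val).
  apply: (@continuous_comp _ _ _ f set_val); first exact: cf.
  exact: initial_continuous.
exact: initial_continuous.
Qed.

(** The images of the centre and of a unit vector, which exists as [n.-1] is positive. Of two such
    points, one is far from any prescribed point. *)
Lemma topological_cball_two_points (D : set (hsphere R n)) : (1 < n)%N ->
  topological_cball D -> exists x y, [/\ D x, D y & x <> y].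
Proof.
move=> n1 [f [h [_ _ fK _]]].
have h0 : (0 : 'rV[R]_n.-1) \in cball R n.-1 by rewrite inE /cball/= enorm0.
have i0 : 'I_n.-1 by apply: (@Ordinal _ 0); lia.
pose b : 'rV[R]_n.-1 := \row_j (j == i0)%:R.
have b1 : enorm b = 1.
  rewrite /enorm (bigD1 i0)//= mxE eqxx expr1n big1 ?addr0 ?sqrtr1// => j /negbTE ji.
  by rewrite mxE ji expr0n.
have hb : b \in cball R n.-1 by rewrite inE /cball/= b1.
exists (set_val (f (exist (fun x => x \in cball R n.-1) _ h0))).
exists (set_val (f (exist (fun x => x \in cball R n.-1) _ hb))).
split; [exact: set_valP | exact: set_valP |].
move=> /val_inj/(can_inj fK)/(congr1 val)/= b0.
by move: b1; rewrite -b0 enorm0 => /eqP; rewrite eq_sym oner_eq0.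
Qed.

(** The set of differences is compact, hence closed, and misses 0. *)
Lemma compact_disjoint_dist (K L : set 'rV[R]_n) : compact K -> compact L ->
  K `&` L = set0 -> exists2 e : R, 0 < e & forall x y, K x -> L y -> e <= enorm (x - y).
Proof.
move=> cK cL KL.
pose f (z : 'rV[R]_n * 'rV[R]_n) : 'rV[R]_n := z.1 - z.2.
have cf : continuous f.
  by move=> z; apply: (@cvgB _ _ _ _ _ fst snd); [exact: cvg_fst | exact: cvg_snd].
have /compact_closed : compact (f @` (K `*` L)).
  by apply: continuous_compact; [exact: continuous_subspaceT | exact: compact_setX].
move=> /(_ (@norm_hausdorff _ _)); rewrite closedE /= => clf.
have n0 : ~ (f @` (K `*` L)) 0.
  move=> [[x y] [/= Kx Ly]] /subr0_eq/= xy.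
  by have : (K `&` L) x by [split; rewrite // xy]; rewrite KL.
have : \forall z \near (0 : 'rV[R]_n), ~ (f @` (K `*` L)) z.
  by apply: contrapT => h; apply: n0; exact: clf.
move=> /nbhs_enorm[e e0 eU]; exists e => // x y Kx Ly.
rewrite leNgt; apply/negP => lt; apply: (eU (x - y)); first by rewrite subr0.
by exists (x, y).
Qed.

End TopologicalBalls.

(** * Ping-pong *)

Lemma finite_set_injective (T : Type) (T' : finType) (A : set T) (f : T -> T') :
  {in A &, injective f} -> finite_set A.
Proof.
move=> finj; pose f' x := if x \in A then Some (f x) else None.
have -> : A = f' @^-1` [set~ None].
  apply/seteqP; split=> x /=; rewrite /f'; first by move=> Ax; rewrite mem_set.
  by case: ifP => [/set_mem|].
apply: finite_preimage; last exact: finite_finset.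
move=> x y; rewrite !inE /f'/=; case: ifP => // xA; case: ifP => // yA _ _ [].
by apply: finj.
Qed.

Section PingPong.
Variables (R : realType) (n k : nat) (gs : 'I_k -> hisom R n).
Variable D : 'I_k * bool -> set (hsphere R n).
Local Notation letter := ('I_k * bool)%type.
Local Notation ev := (eval_word gs).
Local Notation o := (horigin R n).
Implicit Types (p q l : letter) (u v w : seq letter) (xi zeta : hsphere R n).

Hypothesis n1 : (1 < n)%N.
Hypothesis DP : pairs_balls gs D.

Let D_disjoint p q xi : D p xi -> D q xi -> p = q.
Proof. by have [_ + _] := DP; move=> tr Dp Dq; apply: tr => //; exists xi. Qed.

(** The pairing gives this for generators. For the inverse of [g_i], a point landing outside
    [D (i, false)] would be sent back by [g_i] into [D (i, true)], where it was assumed not to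
    be. *)
Let ping_letter p xi : ~ D (linv p) xi -> D p (bnd (eval_letter gs p) xi).
Proof.
have [_ _ pair] := DP.
have ping i zeta : ~ D (i, false) zeta -> D (i, true) (bnd (gs i) zeta).
  move=> nD; have : (hboundary (gs i) @` (~` D (i, false))) (hboundary (gs i) zeta).
    by exists zeta.
  rewrite pair => -[y /interior_subset Dy yz].
  by rewrite (_ : bnd _ _ = y)//; apply: val_inj; rewrite yz.
case: p => i [] nD; first exact: ping.
apply: contrapT => /ping; rewrite bndVK; exact: nD.
Qed.

(** Letters act from the right. Each suffix lands in the ball of its first letter, which reducedness
    keeps different from the ball that the next letter must avoid. *)
Let ping_word u l xi p v : rcons u l = p :: v -> reduced_word (rcons u l) ->
  ~ D (linv l) xi -> D p (bnd (ev (rcons u l)) xi).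
Proof.
elim: u p v => [|q u IH] p v.
  by move=> [<- _] _ nD; rewrite eval_word1; exact: ping_letter.
rewrite rcons_cons => -[<- _] rw nD; rewrite eval_word_cons bndM; apply: ping_letter.
case e : (rcons u l) => [|p' v']; first by move/(congr1 size): e; rewrite size_rcons.
have ru : reduced_word (rcons u l) by have [] := @reduced_cat _ [:: q] _ rw.
have Dp' := IH _ _ e ru nD; rewrite -e => Dq.
have := D_disjoint Dp' Dq; move: rw; rewrite e.
rewrite -[q :: _]/(rcons [::] q ++ p' :: v') reduced_rcons_cons => /and3P[_ _].
by move=> /eqP.
Qed.

Let balls_separated : exists2 e : R, 0 < e & forall p q xi zeta,
  p != q -> D p xi -> D q zeta -> e <= enorm (\val xi - \val zeta).
Proof.
have [balls _ _] := DP.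
have [||e e0 eP] := @finite_lower_bound R (letter * letter)%type (fun z e =>
  forall xi zeta, z.1 != z.2 -> D z.1 xi -> D z.2 zeta ->
    e <= enorm (\val xi - \val zeta)).
- by move=> z e e' eP e'e xi zeta ne Dx Dz; apply: le_trans e'e _; exact: eP.
- move=> [p q]/=; have [->|ne] := eqVneq p q.
    by exists 1.
  have [|e e0 eP] := compact_disjoint_dist (topological_cball_compact (balls p))
    (topological_cball_compact (balls q)).
    rewrite -subset0 => _ [[x Dx <-] [y Dy /val_inj yx]].
    by move: ne; rewrite yx in Dy; rewrite (D_disjoint Dx Dy) eqxx.
  by exists e => // xi zeta _ Dx Dz; apply: eP; [exists xi | exists zeta].
by exists e => // p q xi zeta; exact: (eP (p, q)).
Qed.

Let two_points : exists2 e : R, 0 < e & forall p, exists xi zeta,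
  [/\ D p xi, D p zeta & e <= enorm (\val xi - \val zeta)].
Proof.
have [balls _ _] := DP.
apply: (@finite_lower_bound R _ (fun p e => exists xi zeta,
  [/\ D p xi, D p zeta & e <= enorm (\val xi - \val zeta)])).
  move=> p e e' [xi [zeta [? ? le]]] e'e; exists xi, zeta; split => //.
  exact: le_trans le.
move=> p; have [xi [zeta [Dx Dz ne]]] := topological_cball_two_points n1 (balls p).
exists (enorm (\val xi - \val zeta)); last by exists xi, zeta.
rewrite lt_def enorm_ge0 andbT; apply/eqP => /enorm_eq0/subr0_eq/val_inj.
exact: ne.
Qed.

(* [conf (u o) = 1 / dil u], and one of two points of the ball [D l] stays away
   from [u^-1 o], so [bnd_shadow] puts [u o] near its image, which lies in [D p]. *)
Let orbit_near_ball (e : R) : 0 < e -> exists T : R, forall u l p v,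
  rcons u l = p :: v -> reduced_word (rcons u l) -> T < dil (ev (rcons u l)) ->
  exists2 xi, D p xi & enorm (\val xi - \val (ev (rcons u l) o)) <= e.
Proof.
move=> e0; have [d d0 dP] := two_points.
(* Makes [conf (g o) < e * d / 2]; dividing by the distance [d / 2] in [bnd_shadow] leaves [e]. *)
exists (2 / (e * d)) => u l p v ulpv rw; set g := ev _ => dg.
have [xi [zeta [Dx Dz xz]]] := dP l.
have lnD x : D l x -> ~ D (linv l) x.
  by move=> Dl /(D_disjoint Dl) ll; have := linv_neq l; rewrite -ll eqxx.
have near x : D l x -> d / 2 <= enorm (\val x - \val ((g^-1)%g o)) ->
    exists2 xi, D p xi & enorm (\val xi - \val (g o)) <= e.
  move=> Dl far; exists (bnd g x); first exact: ping_word ulpv rw (lnD _ Dl).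
  have d2 : 0 < d / 2 by rewrite divr_gt0.
  rewrite -(ler_pM2r d2).
  apply: le_trans (ler_wpM2l (enorm_ge0 _) far) _.
  apply: le_trans (bnd_shadow _ _) _.
  have c0 := conf_gt0 (g o).
  move: dg; rewrite /dil ltr_pdivrMr ?mulr_gt0// => dg.
  have : 2 * conf (\val (g o)) < e * d.
    have := dg; rewrite -(ltr_pM2r c0) mulrAC mulVf ?mul1r//; last exact: lt0r_neq0.
  lra.
have [far|close] := leP (d / 2) (enorm (\val xi - \val ((g^-1)%g o))).
  exact: near far.
apply: (near zeta) => //.
have := enorm_dist_triangle (\val ((g^-1)%g o)) (\val xi) (\val zeta).
rewrite (enormBC (\val ((g^-1)%g o))); lra.
Qed.

(** If both displacements are large, the orbit points of [v] and [u^-1] lie near the balls of the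
    distinct letters [q] and [linv l], hence [e / 3] apart, and [odistM_ge] applies. A small
    displacement is absorbed by [odistM]. *)
Lemma odist_red : exists2 C : R, 0 <= C & forall u v, reduced_word (u ++ v) ->
  odist (ev u) + odist (ev v) <= odist (ev (u ++ v)) + C.
Proof.
have [e e0 eP] := balls_separated.
have e3 : 0 < e / 3 by rewrite divr_gt0.
have [T TP] := orbit_near_ball e3.
(* With [S >= 1] the empty word, whose [dil] is 1, counts as small. *)
pose S := Num.max T 1.
have S0 : 0 < S by rewrite lt_max ltr01 orbT.
pose C1 := ln (16 / (e / 3) ^+ 2); pose C2 : R := ln (4 * S); pose C3 : R := ln 16.
exists (`|C1| + 2 * `|C2| + `|C3|) => [|u v ruv].
  by rewrite !addr_ge0// mulr_ge0.
have n1C := ler_norm C1; have n2C := ler_norm C2; have n3C := ler_norm C3.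
have p1 := normr_ge0 C1; have p2 := normr_ge0 C2; have p3 := normr_ge0 C3.
have small g : dil g <= S -> odist g <= C2.
  move=> gS; rewrite -ler_expR /C2 lnK ?posrE ?mulr_gt0//.
  have /andP[_ /le_trans->//] := expR_odist g; first by rewrite ler_pM2l.
have [/small su|bu] := leP (dil (ev u)) S.
  have := odistM ((ev u)^-1)%g (ev u * ev v)%g.
  rewrite mulgA mulVg mul1g odistV -eval_word_cat -/C3; lra.
have [/small sv|bv] := leP (dil (ev v)) S.
  have := odistM (ev u * ev v)%g ((ev v)^-1)%g.
  rewrite -mulgA mulgV mulg1 odistV -eval_word_cat -/C3; lra.
have dil1 : dil (1%g : hisom R n) = 1.
  by rewrite /dil/= conf0 invr1.
have S1 : 1 <= S by rewrite le_max lexx orbT.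
have TS : T <= S by rewrite le_max lexx.
case: v bv ruv => [|q v] bv ruv.
  by move: bv; rewrite eval_word0 dil1 ltNge S1.
case/lastP: u bu ruv => [|u l] bu ruv.
  by move: bu; rewrite eval_word0 dil1 ltNge S1.
have /and3P[ru rv ql] : [&& reduced_word (rcons u l), reduced_word (q :: v) &
  q != linv l] by rewrite -reduced_rcons_cons.
have Tv : T < dil (ev (q :: v)) by exact: le_lt_trans bv.
have Tu : T < dil (ev (winv (rcons u l))).
  by rewrite eval_word_winv dilV; exact: le_lt_trans bu.
have [xi Dxi xie] : exists2 xi, D q xi & enorm (\val xi - \val (ev (q :: v) o)) <= e / 3.
  move: Tv rv; case e1 : (q :: v) / lastP => [|v' l']// Tv rv.
  exact: TP (esym e1) rv Tv.
have [zeta Dz ze] : exists2 xi, D (linv l) xi &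
    enorm (\val xi - \val (ev (winv (rcons u l)) o)) <= e / 3.
  move: Tu; have : reduced_word (winv (rcons u l)) by rewrite reduced_winv.
  have := winv_rcons l u.
  case: (winv (rcons u l)) / lastP => [|v' l']// e1 rw Tu.
  exact: TP e1 rw Tu.
have far : e / 3 <= enorm (\val (ev (q :: v) o) - \val ((ev (rcons u l))^-1%g o)).
  rewrite -eval_word_winv.
  have := eP _ _ _ _ ql Dxi Dz.
  have := enorm_dist_triangle (\val (ev (q :: v) o)) (\val xi) (\val zeta).
  have := enorm_dist_triangle (\val (ev (winv (rcons u l)) o))
    (\val (ev (q :: v) o)) (\val zeta).
  rewrite (enormBC (\val (ev (winv (rcons u l)) o)) (\val zeta)); lra.
have := odistM_ge e3 far; rewrite -/C1 -eval_word_cat; lra.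
Qed.

Variable G : set (hisom R n).
Hypothesis fgG : freely_generates gs G.

(* A reduced word from the letter [p] to the letter [l] maps into [D p] every
   ball other than [D (linv l)]; with at least four balls, one such ball is not
   [D p] itself. *)
Let moves_some_point (e : R) (z : letter -> hsphere R n) : (1 < k)%N ->
  (forall p, D p (z p)) ->
  (forall p q xi zeta, p != q -> D p xi -> D q zeta -> e <= enorm (\val xi - \val zeta)) ->
  forall x, G x -> x <> 1%g ->
  exists q, e <= enorm (\val (bnd x (z q)) - \val (z q)).
Proof.
move=> k1 Dz eP x /(gen_surj fgG)[w rw <-] w1.
case: w rw w1 => [|p v]; first by rewrite eval_word0.
case ew : (p :: v) / lastP => [|u l]// rw _.
have [q qp ql] : exists2 q, p != q & q != linv l.
  apply: contrapT => noq.
  have : (#|{: letter}| <= #|[set p; linv l]%SET|)%N.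
    apply: subset_leq_card; apply/fintype.subsetP => q _; rewrite !inE.
    apply: contraT; rewrite negb_or eq_sym => /andP[? ?].
    by case: noq; exists q.
  rewrite card_prod card_ord card_bool; have : (#|[set p; linv l]%SET| <= 2)%N.
    by rewrite cards2; case: (_ != _).
  lia.
exists q; apply: (eP _ _ _ _ qp _ (Dz q)); apply: ping_word (esym ew) rw _.
by move=> /(D_disjoint (Dz q)) qe; rewrite qe eqxx in ql.
Qed.

(** Pigeonhole: record the images of the chosen points [z q] up to a grid of mesh [1 / M]. Two
    elements in one cell differ by an [x] that moves every [z q] by less than [e], so [x = 1]. *)
Let odist_finite (T : R) : (1 < k)%N ->
  finite_set [set u | reduced_word u /\ odist (ev u) <= T].
Proof.
move=> k1; set S := [set u | _].
have [e e0 eP] := balls_separated.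
have [balls _ _] := DP.
have exD p : exists xi, D p xi.
  by have [xi [_ [Dxi _ _]]] := topological_cball_two_points n1 (balls p); exists xi.
have [z Dz] := choice exD.
pose K := 4 * expR T.
have K0 : 0 < K by rewrite mulr_gt0 ?expR_gt0.
(* So fine that a grid cell, of Euclidean diameter at most [n / M], stays below [e] after the
   [K]-Lipschitz map [bnd (ev u)^-1]. *)
pose M := (Num.bound (K * n%:R / e)).+1.
have M0 : 0 < M%:R :> R by rewrite ltr0n.
have MP : K * (n%:R / M%:R) < e.
  rewrite mulrA ltr_pdivrMr// [ltRHS]mulrC -ltr_pdivrMr//.
  apply: (@lt_trans _ _ (Num.bound (K * n%:R / e))%:R); last by rewrite ltr_nat.
  by apply: archi_boundP; rewrite divr_ge0 ?mulr_ge0 ?(ltW K0) ?(ltW e0).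
pose t u (pi : letter * 'I_n) : R := (\val (bnd (ev u) (z pi.1)) 0 pi.2 + 1) * M%:R.
have t_range u pi : 0 <= t u pi < (2 * M).+1%:R.
  have : `|\val (bnd (ev u) (z pi.1)) 0 pi.2| <= 1.
    by apply: le_trans (coord_le_enorm _ _) _; rewrite hsphereP.
  rewrite ler_norml /t -natr1 natrM => /andP[h1 h2].
  rewrite mulr_ge0//=; last lra.
  move: (fun_of_matrix _ _ _) h1 h2 => c h1 h2.
  have : (c + 1) * M%:R <= 2 * M%:R by rewrite ler_pM2r//; lra.
  lra.
pose cell u := [ffun pi => inord (Num.truncn (t u pi)) : 'I_(2 * M).+1].
have cellP u v : cell u = cell v -> forall pi, `|t u pi - t v pi| <= 1.
  move=> /ffunP cuv pi; have /andP[u0 u2] := t_range u pi.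
  have /andP[v0 v2] := t_range v pi.
  have := cuv pi; rewrite !ffunE => /(congr1 val).
  rewrite /= !inordK ?truncn_lt_nat// => e1.
  have /andP[a1 a2] := truncn_itv u0; have /andP[b1 b2] := truncn_itv v0.
  rewrite e1 in a1 a2; rewrite -natr1 in a2; rewrite -natr1 in b2.
  by rewrite ler_norml; lra.
apply: (@finite_set_injective _ _ _ cell) => u v.
move=> /set_mem[ru uT] /set_mem[rv vT] cuv; apply: contrapT => uv.
pose x := ((ev u)^-1 * ev v)%g.
have Gx : G x.
  by rewrite /x -eval_word_winv -eval_word_cat; exact: gen_eval.
have x1 : x <> 1%g.
  move=> x1; apply: uv; apply: (eval_word_inj fgG) => //.
  by apply: (mulgI (ev u)^-1%g); rewrite mulVg -/x x1.
have [q] := moves_some_point k1 Dz eP Gx x1.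
apply/negP; rewrite -ltNge; apply: le_lt_trans MP.
rewrite -{2}(bndK (ev u) (z q)) /x bndM.
apply: le_trans (bnd_lipschitz _ _ _) _; rewrite dilV.
have dT : 4 * dil (ev u) <= K.
  rewrite ler_pM2l//; have /andP[/le_trans + _] := expR_odist (ev u).
  by apply; rewrite ler_expR.
apply: ler_pM => //; first by rewrite mulr_ge0// ltW// dil_gt0.
  exact: enorm_ge0.
apply: le_trans (enorm_le_norm _) _; apply: ler_wpM2l => //.
rewrite [leLHS]/Num.norm/= mx_normrE; apply/bigmax_leP; split.
  by rewrite invr_ge0.
move=> [i j] _ /=; rewrite (ord1 i) !mxE.
have := cellP _ _ cuv (q, j); rewrite /t /= -mulrBl normrM (gtr0_norm M0) opprD addrACA subrr addr0.
by rewrite distrC -ler_pdivlMr// div1r.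
Qed.

Lemma odist_proper : (1 < k)%N -> forall T : R, exists m,
  forall u, reduced_word u -> (m < size u)%N -> T < odist (ev u).
Proof.
move=> k1 T; have /finite_seqP[s sP] := odist_finite T k1.
exists (\max_(u <- s) size u)%N => u ru su; rewrite ltNge; apply/negP => uT.
have us : u \in s by have : [set` s] u by rewrite -sP.
by move: su; rewrite ltnNge => /negP; apply; exact: leq_bigmax_seq.
Qed.

End PingPong.

(** * Groups of rank one *)

Section RankOne.
Variables (R : realType) (n k : nat) (gs : 'I_k -> hisom R n).
Variables (D : 'I_k * bool -> set (hsphere R n)) (G : set (hisom R n)).
Local Notation letter := ('I_k * bool)%type.
Local Notation ev := (eval_word gs).
Local Notation o := (horigin R n).
Implicit Types (p q l : letter) (u v w : seq letter).

Hypothesis n1 : (1 < n)%N.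
Hypothesis DP : pairs_balls gs D.
Hypothesis fgG : freely_generates gs G.
Hypothesis k1 : (k <= 1)%N.

Let letter_index p q : p.1 = q.1.
Proof. by apply: ord_inj; have := ltn_ord p.1; have := ltn_ord q.1; lia. Qed.

Let same_sign (b : bool) w := all (fun p : letter => p.2 == b) w.

Let reduced_same_sign w : reduced_word w -> exists b, same_sign b w.
Proof.
case: w => [|p w]; first by exists true.
move=> rw; exists p.2; rewrite /same_sign/= eqxx /=.
elim: w p rw => [|q w IH] p //=; rewrite -/(linv p) => /andP[qp /IH].
have pq : q.2 = p.2.
  move: qp (letter_index q p); case: (q) => i c /= + ip; rewrite ip xpair_eqE eqxx.
  by case: c; case: (p.2).
by rewrite pq eqxx.
Qed.

Let same_sign_prefix b w w' : same_sign b w -> same_sign b w' ->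
  (size w <= size w')%N -> w' = w ++ drop (size w) w'.
Proof.
move=> bw bw' sz; rewrite -{1}(cat_take_drop (size w) w'); congr (_ ++ _).
have st : size (take (size w) w') = size w by rewrite size_takel.
case: w bw sz st => [|p w] bw sz st; first by rewrite take0.
apply: (@eq_from_nth _ p) => // i; rewrite st => iw; rewrite nth_take//.
have /eqP := all_nthP p bw i iw.
have /eqP := all_nthP p bw' i (leq_trans iw sz).
move: (nth _ _ _) (nth _ _ _) => x y xb yb.
by move: xb yb (letter_index x y); case: x; case: y => /= ? ? ? ? -> -> ->.
Qed.

(** Of two words of one sign, the shorter [w] is a prefix of [w'], so [odist_red] bounds the
    displacement of [w^-1 w'] by that of [w'] minus that of [w]. If their orbit points are far
    apart, [odistM_ge] bounds it below by the sum, so [w] has bounded displacement and its orbit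
    point cannot be near the sphere. *)
Let same_sign_limit b (xi eta : 'rV[R]_n) :
  let X := [set \val (ev w o) | w in [set w | reduced_word w /\ same_sign b w]] in
  hsphere R n xi -> hsphere R n eta -> closure X xi -> closure X eta -> xi = eta.
Proof.
move=> X sxi seta Xxi Xeta; apply: contrapT => ne.
pose e := enorm (xi - eta).
have e0 : 0 < e.
  by rewrite lt_def enorm_ge0 andbT; apply/eqP => /enorm_eq0/subr0_eq.
have e3 : 0 < e / 3 by rewrite divr_gt0.
have [C C0 red] := odist_red n1 DP.
pose C1 := C + ln (16 / (e / 3) ^+ 2).
have key w w' : reduced_word w' -> same_sign b w -> same_sign b w' ->
    (size w <= size w')%N -> e / 3 <= enorm (\val (ev w' o) - \val (ev w o)) ->
    2 * odist (ev w) <= C1.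
  move=> rw' bw bw' sz far.
  have e1 := same_sign_prefix bw bw' sz.
  have := @odistM_ge _ _ ((ev w)^-1)%g (ev w') _ e3; rewrite invgK => /(_ far).
  have := red w (drop (size w) w'); rewrite -e1 => /(_ rw').
  have -> : ev (drop (size w) w') = ((ev w)^-1 * ev w')%g.
    by rewrite {2}e1 eval_word_cat mulgA mulVg mul1g.
  by rewrite odistV /C1; lra.
(* The second term forces [conf < expR (- (C1 / 2))] within distance [d] of the sphere, hence
   displacement above [C1 / 2]. *)
pose d := Num.min (e / 3) (expR (- (C1 / 2)) / 4).
have d0 : 0 < d by rewrite lt_min e3 divr_gt0// expR_gt0.
have de : d <= e / 3 by rewrite ge_min lexx.
have dC : d <= expR (- (C1 / 2)) / 4 by rewrite ge_min lexx orbT.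
have far_out z w : hsphere R n z -> enorm (\val (ev w o) - z) < d ->
    C1 < 2 * odist (ev w).
  move=> z1 wz; suff : C1 / 2 < odist (ev w) by lra.
  rewrite -ltr_expR; have /andP[+ _] := expR_odist (ev w); apply: lt_le_trans.
  rewrite -[expR _]invrK /dil ltf_pV2 ?posrE ?conf_gt0 ?invr_gt0 ?expR_gt0//.
  rewrite -expRN.
  have := enorm_dist (\val (ev w o)) z; rewrite z1 => /le_trans/(_ (ltW wz)).
  have := hspaceP (ev w o); rewrite /conf ler_norml.
  have : 0 < expR (- (C1 / 2)) by exact: expR_gt0.
  move: dC; move: (expR _) => E; move: (enorm _) => s.
  move=> dC E0 s1 /andP[s2 _].
  have : 1 - s ^+ 2 <= 2 * (1 - s) by have := sqr_ge0 (1 - s); rewrite sqrrB; lra.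
  lra.
have [|_ [[w [rw bw] <-] wxi]] := Xxi [set y | enorm (y - xi) < d].
  by apply/nbhs_enorm; exists d.
have [|_ [[w' [rw' bw'] <-] weta]] := Xeta [set y | enorm (y - eta) < d].
  by apply/nbhs_enorm; exists d.
have far : e / 3 <= enorm (\val (ev w' o) - \val (ev w o)).
  have := enorm_dist_triangle (\val (ev w o)) xi eta.
  have := enorm_dist_triangle (\val (ev w' o)) (\val (ev w o)) eta.
  rewrite -/e (enormBC xi) (enormBC (\val (ev w o)) (\val (ev w' o))).
  by move: wxi weta => /=; lra.
have [sz|sz] := leqP (size w) (size w').
  by have := key w w' rw' bw bw' sz far; rewrite leNgt (far_out xi).
have := key w' w rw bw' bw (ltnW sz); rewrite enormBC => /(_ far).
by rewrite leNgt (far_out eta).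
Qed.

(** Each sign contributes at most one limit point. Non-elementarity therefore provides the two
    generators that [bridge] and the fourth ball require. *)
Lemma rank_one_elementary : ~ non_elementary G.
Proof.
move=> ne; apply: ne.
pose X b := [set \val (ev w o) | w in [set w | reduced_word w /\ same_sign b w]].
have limX b : exists a, hsphere R n `&` closure (X b) `<=` [set a].
  have [[a [sa Xa]]|no] := pselect (exists a, (hsphere R n `&` closure (X b)) a).
    by exists a => x [sx Xx]; exact: (@same_sign_limit b).
  by exists 0 => x Xx; case: no; exists x.
have [a aP] := limX true; have [b bP] := limX false.
exists a, b => x [sx clx].
have sub : [set \val (g o) | g in G] `<=` X true `|` X false.
  move=> _ [g Gg <-]; have [w rw <-] := gen_surj fgG Gg.
  by have [[] bw] := reduced_same_sign rw; [left|right]; exists w.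
have : closure (X true `|` X false) x by exact: closureS sub _ clx.
by rewrite closureU => -[Xx|Xx]; [left; apply: aP | right; apply: bP].
Qed.

End RankOne.

(** * Schottky groups *)

Section PoincareSeries.
Variables (R : realType) (n : nat).
Implicit Types (G N : set (hisom R n)).

(** The sphere at infinity is empty for [n = 0] and consists of 1 and -1 for [n = 1]. *)
Lemma low_dim_elementary G : (n <= 1)%N -> ~ non_elementary G.
Proof.
move=> n1; apply; exists (const_mx 1), (const_mx (-1)) => x [x1 _].
have n_eq1 : n = 1%N.
  case: n n1 x x1 => [|[|m]]// _ x; rewrite /hsphere/= /enorm big_ord0 sqrtr0.
  by move/esym/eqP; rewrite oner_eq0.
clear n1; subst n; move: x1; rewrite /hsphere/= /enorm big_ord1 sqrtr_sqr => x1.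
have [x0|x0] := leP 0 (x 0 0); [left|right]; apply/rowP => i; rewrite (ord1 i) mxE.
  by rewrite -x1 ger0_norm.
by rewrite -x1 ltr0_norm// opprK.
Qed.

Lemma sums_bounded_poincare G s B : 0 <= B ->
  sums_bounded G (fun x => expR (- s * odist x)) B -> (poincare_series G s <= B%:E)%E.
Proof.
move=> B0 GB; apply: ge_ereal_sup => _ [X [finX XG] <-].
rewrite fsbig_finite//= sumEFin lee_fin; apply: GB; first exact: finmap.fset_uniq.
by move=> x; rewrite in_fset_set// => /set_mem/XG.
Qed.

Lemma words_sums_poincare G k (g : 'I_k -> hisom R n) s B :
  freely_generates g G ->
  sums_bounded (fun u => reduced_word u)
    (fun u => expR (- s * odist (eval_word g u))) B ->
  (poincare_series G s < +oo)%E.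
Proof.
move=> fgG wB; have B0 : 0 <= B by have := wB [::] isT; rewrite big_nil; apply.
apply: (@le_lt_trans _ _ B%:E); last exact: ltry.
apply: sums_bounded_poincare => // t ut tG.
have ex x : exists w, G x -> reduced_word w /\ eval_word g w = x.
  have [Gx|nGx] := pselect (G x); last by exists [::].
  by have [w rw ew] := gen_surj fgG Gx; exists w.
have [f fP] := choice ex.
have := wB [seq f x | x <- t].
rewrite map_inj_in_uniq => [|x y /tG/fP[_ fx] /tG/fP[_ fy] fxy]; last first.
  by rewrite -fx -fy fxy.
move=> /(_ ut) fB; apply: le_trans (fB _); last first.
  by move=> _ /mapP[x /tG/fP[rx _] ->].
rewrite big_map big_seq [leRHS]big_seq; apply: ler_sum => x /tG/fP[_ fx].
by rewrite fx lexx.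
Qed.

Lemma poincare_sums_bounded G s : (poincare_series G s < +oo)%E ->
  exists B, sums_bounded G (fun x => expR (- s * odist x)) B.
Proof.
move=> fin; exists (fine (poincare_series G s)) => t ut tG.
have ser0 : (0 <= poincare_series G s)%E.
  by apply: esum_ge0 => x _; rewrite lee_fin expR_ge0.
rewrite -lee_fin fineK ?ge0_fin_numE// -sumEFin fsbig_seq//.
apply: ereal_sup_ubound; exists [set` t] => //.
by split; [exact: finite_seq | exact: tG].
Qed.

Lemma poincare_series_le G N s s' : N `<=` G -> s <= s' ->
  (poincare_series N s' <= poincare_series G s)%E.
Proof.
move=> NG ss'; apply: (@le_trans _ _ (poincare_series N s)).
  apply: le_esum => x _; rewrite lee_fin ler_expR ler_wpM2r ?lerN2//.
  exact: odist_ge0.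
apply: ge_ereal_sup => _ [X [finX XN] <-]; apply: ereal_sup_ubound.
by exists X => //; split => //; exact: subset_trans NG.
Qed.

End PoincareSeries.

Theorem corollary1p6 (R : realType) (n : nat) (G N : set (hisom R n)) :
  schottky G -> non_elementary G -> semidirect_int G N ->
  poincare_exponent N = poincare_exponent G /\ divergence_type N.
Proof.
move=> [_ [k [g [D [fgG DP]]]]] ne [[[/set_mem N1 _] NG _] [phi [[_ phi_inj phi_surj] phiM]]].
have n1 : (1 < n)%N by rewrite ltnNge; apply/negP => /(@low_dim_elementary R n G).
have k1 : (1 < k)%N.
  by rewrite ltnNge; apply/negP => /(rank_one_elementary n1 DP fgG).
pose psi x := phi (left_coset N x).
have psiM x y : G x -> G y -> psi (x * y)%g = psi x + psi y by exact: phiM.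
have psi_surj j : exists2 x, G x & psi x = j.
  by have [_ [x Gx <-] <-] := phi_surj j I; exists x.
have G1 : G 1%g by rewrite -(eval_word0 g); exact: gen_eval.
have psi1 : psi 1%g = 0.
  by have := psiM _ _ G1 G1; rewrite mulg1 -{1}[psi _]addr0 => /addrI.
(* Injectivity of [phi] on cosets puts [x] in the coset of 1. *)
have kerN x : G x /\ psi x = 0 -> N x.
  move=> [Gx psix].
  have : left_coset N x = left_coset N 1%g.
    apply: phi_inj; [by apply/mem_set; exists x | by apply/mem_set; exists 1%g |].
    by rewrite -/(psi x) psix -psi1.
  move=> xN; have : left_coset N x x by exists 1%g; rewrite ?mulg1.
  by rewrite xN => -[y Ny <-]; rewrite mul1g.
have [C1 C1_ge0 red1] := odist_red n1 DP.
have proper := odist_proper n1 DP fgG k1.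
(* One constant for both the lower bound on reduced products and the triangle inequality. *)
pose C := Num.max C1 (ln 16).
have C0 : 0 <= C by rewrite le_max C1_ge0.
have red u v : reduced_word (u ++ v) ->
    odist (eval_word g u) + odist (eval_word g v) <= odist (eval_word g (u ++ v)) + C.
  by move=> /red1/le_trans; apply; rewrite lerD2l le_max lexx.
have tri (x y : hisom R n) : odist (x * y)%g <= odist x + odist y + C.
  by apply: le_trans (odistM x y) _; rewrite lerD2l le_max lexx orbT.
pose d u := odist (eval_word g u).
have d0 u : 0 <= d u by exact: odist_ge0.
have inf_ge0 : (0 <= poincare_exponent G)%E.
  by apply: le_ereal_inf_tmp => _ [s [s0 _] <-]; rewrite lee_fin.
have inf_le s : 0 <= s /\ (poincare_series G s < +oo)%E ->
    (poincare_exponent G <= s%:E)%E.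
  by move=> Ss; apply: ereal_inf_lbound; exists s.
have [s0 [m0 [s0_ge0 m0_gt0 small]]] := @zsum_small R k d C proper.
have [B0 B0P] := @zsum_bounded R k d C red _ _ s0_ge0 m0_gt0 small.
have fin : poincare_exponent G \is a fin_num.
  rewrite ge0_fin_numE//; apply: le_lt_trans (ltry s0); apply: inf_le; split => //.
  exact: words_sums_poincare fgG B0P.
pose del := fine (poincare_exponent G).
have delE : poincare_exponent G = del%:E by rewrite /del fineK.
have del0 : 0 <= del by rewrite -lee_fin -delE.
have crit s : 0 <= s -> s < del -> forall B, ~ sums_bounded
    (fun u => reduced_word u) (fun u => expR (- s * d u)) B.
  move=> s_ge0 sdel B /(words_sums_poincare fgG) fins; have := inf_le s (conj s_ge0 fins).
  by rewrite delE lee_fin leNgt sdel.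
have serN : poincare_series N del = +oo%E.
  apply: contrapT => nfin.
  have [|B BP] := @poincare_sums_bounded _ _ N del; first by rewrite ltey; exact/eqP.
  apply: (@kernel_sums_unbounded R k _ g G (@odist R n) C psi del (expR (- (del * C))) B)
    => //; first exact: odistV.
  - exact: expR_gt0.
  - move=> m m0'; rewrite expRN -[leLHS]mulr1 ler_pdivrMl ?expR_gt0//.
    exact: @zsum_critical R k d C d0 red C0 del m (ltnW k1) del0 crit m0'.
  - by move=> t ut tP; apply: BP => // x /tP/kerN.
(* One inequality is monotonicity in the group. For the other, convergence for [N] at some [s < del]
   would give convergence at [del], against [serN]. *)
have expE : poincare_exponent N = poincare_exponent G.
  apply/eqP; rewrite eq_le; apply/andP; split.
    apply: ereal_inf_le_tmp => _ [s [s_ge0 sG] <-]; exists s => //; split => //.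
    exact: le_lt_trans (poincare_series_le NG (lexx s)) sG.
  rewrite delE; apply: le_ereal_inf_tmp => _ [s [s_ge0 sN] <-].
  rewrite lee_fin leNgt; apply/negP => /ltW sdel.
  have := poincare_series_le (@subset_refl _ N) sdel.
  by rewrite serN leye_eq => /eqP sE; rewrite sE in sN.
by split; [exact: expE | rewrite /divergence_type expE; exact: serN].
Qed.
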